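(* Let $H(q,p)=\frac{1}{2m(q)}\,p^2+u_0(q)\,p+V(q)$ on $\mathbb{R}\times\mathbb{R}$, where $m,u_0,V$ are smooth real functions of $q$ and $1/m$ is positive and bounded away from zero. Then the secular expansion (defined in the context) is valid for $H$ for all endpoints $q_A\neq q_B$ if and only if the mass $m$ is constant. Moreover, in this case the leading momentum coefficient is $$\pi_{-1}(\tau)=m\,(q_B-q_A)\qquad\text{for all }\tau\in[0,1].$$
   Context: Fix $q_A\neq q_B$. For $\varepsilon=t_B-t_A>0$, consider a solution $(q(t),p(t))$, $t\in[t_A,t_B]$, of Hamilton's equations $\dot q=\frac{\partial H}{\partial p}$, $\dot p=-\frac{\partial H}{\partial q}$ with $q(t_A)=q_A$, $q(t_B)=q_B$. Put $\tau=(t-t_A)/(t_B-t_A)\in[0,1]$, $\tilde q_\varepsilon(\tau)=q(t)$, $\tilde p_\varepsilon(\tau)=p(t)$. Thus $\frac{d}{d\tau}\tilde q_\varepsilon=\varepsilon\,\frac{\partial H}{\partial p}(\tilde q_\varepsilon,\tilde p_\varepsilon)$, $\frac{d}{d\tau}\tilde p_\varepsilon=-\varepsilon\,\frac{\partial H}{\partial q}(\tilde q_\varepsilon,\tilde p_\varepsilon)$, $\tilde q_\varepsilon(0)=q_A$, $\tilde q_\varepsilon(1)=q_B$. Write $\overleftrightarrow{q}(\tau)=(1-\tau)q_A+\tau q_B$. The secular expansion is valid for $H$ with endpoints $q_A,q_B$ if for all sufficiently small $\varepsilon>0$ such a solution exists with, as $\varepsilon\to0^+$, the asymptotic expansions $$\tilde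 q_\varepsilon(\tau)=\overleftrightarrow{q}(\tau)+\sum_{n=1}^\infty\varepsilon^n\chi_n(\tau),\qquad \tilde p_\varepsilon(\tau)=\sum_{n=-1}^\infty\pi_n(\tau)\,\varepsilon^n ,$$ holding uniformly on $[0,1]$ (i.e. truncating after the $\varepsilon^N$ term leaves an error $O(\varepsilon^{N+1})$ uniformly in $\tau$, for every $N$), where $\chi_n,\pi_n$ are smooth functions on $[0,1]$ independent of $\varepsilon$. The expansions may be differentiated term by term in $\tau$. *)

(* Defs.v *)
From Stdlib Require Import Reals ZArith.
From Coquelicot Require Import Coquelicot.
Open Scope R_scope.

Definition smooth (f : R -> R) : Prop :=
  forall (n : nat) (x : R), ex_derive_n f n x.

Definition unit_interval (tau : R) : Prop := 0 <= tau <= 1.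

(* [g] is the [k]-th derivative of [f] on [D].  Derivatives are Stdlib's [D_in], within
   [D], hence are one-sided at the endpoints when [D] is a closed interval. *)
Fixpoint is_derive_n_on (D : R -> Prop) (f : R -> R) (k : nat) (g : R -> R)
    : Prop :=
  match k with
  | O => forall x, D x -> g x = f x
  | S k' => exists h, is_derive_n_on D f k' h /\
                      forall x, D x -> D_in h g D x
  end.

Definition smooth_on (D : R -> Prop) (f : R -> R) : Prop :=
  forall k : nat, exists g, is_derive_n_on D f k g.

Definition hamiltonian (m u0 V : R -> R) (q p : R) : R :=
  / (2 * m q) * p ^ 2 + u0 q * p + V q.

(* Solutions on [0,1] of Hamilton's equations in the rescaled time
   tau = (t - tA) / eps, where eps = tB - tA; both sides of the equations are
   thereby multiplied by eps. *)
Definition rescaled_solution (H : R -> R -> R) (qA qB eps : R) (q p : R -> R)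
    : Prop :=
  (forall tau, unit_interval tau ->
     D_in q (fun s => eps * Derive (fun y => H (q s) y) (p s))
       unit_interval tau) /\
  (forall tau, unit_interval tau ->
     D_in p (fun s => - eps * Derive (fun x => H x (p s)) (q s))
       unit_interval tau) /\
  q 0 = qA /\ q 1 = qB.

Definition segment (qA qB tau : R) : R := (1 - tau) * qA + tau * qB.

(* Truncations after the eps^N term; the first sum is empty for N = 0. *)
Definition q_truncation (qA qB : R) (chi : nat -> R -> R) (N : nat)
    (eps tau : R) : R :=
  segment qA qB tau + sum_n_m (fun n => eps ^ n * chi n tau) 1 N.

(* The summation index is shifted by one: k runs over 0..N+1 and the power of
   eps is n = k - 1, running over -1..N. *)
Definition p_truncation (pi : Z -> R -> R) (N : nat) (eps tau : R) : R :=
  sum_n_m (fun k : nat => let n := (Z.of_nat k - 1)%Z in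
                          pi n tau * powerRZ eps n) 0 (S N).

(* The remainder [r eps tau] is O(eps^n) as eps -> 0+, uniformly in tau on
   [0,1], and so are all its tau-derivatives.  The case k = 0 is the expansion
   itself; by linearity of differentiation, the case k > 0 says that the
   expansion may be differentiated k times term by term. *)
Definition uniform_remainder (r : R -> R -> R) (n : nat) : Prop :=
  forall k : nat, exists C eps1 : R, 0 < eps1 /\
    forall eps, 0 < eps < eps1 ->
      exists g, is_derive_n_on unit_interval (r eps) k g /\
        forall tau, unit_interval tau -> Rabs (g tau) <= C * eps ^ n.

(* [q eps] and [p eps] are the rescaled solutions (their values matter only for
   small eps > 0); [chi n] is used for n >= 1 and [pi n] for n >= -1. *)
Definition secular_expansion (H : R -> R -> R) (qA qB : R)
    (q p : R -> R -> R) (chi : nat -> R -> R) (pi : Z -> R -> R) : Prop :=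
  (exists eps0 : R, 0 < eps0 /\
     forall eps, 0 < eps < eps0 ->
       rescaled_solution H qA qB eps (q eps) (p eps)) /\
  (forall n : nat, (1 <= n)%nat -> smooth_on unit_interval (chi n)) /\
  (forall n : Z, (-1 <= n)%Z -> smooth_on unit_interval (pi n)) /\
  (forall N : nat,
     uniform_remainder
       (fun eps tau => q eps tau - q_truncation qA qB chi N eps tau) (S N)) /\
  (forall N : nat,
     uniform_remainder
       (fun eps tau => p eps tau - p_truncation pi N eps tau) (S N)).

Definition secular_expansion_valid (H : R -> R -> R) (qA qB : R) : Prop :=
  exists (q p : R -> R -> R) (chi : nat -> R -> R) (pi : Z -> R -> R),
    secular_expansion H qA qB q p chi pi.

(* Main.v *)
Require Import Defs.
From Stdlib Require Import Reals ZArith Lra Lia ClassicalEpsilon.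
From Coquelicot Require Import Coquelicot.
Open Scope R_scope.

(* If the expansion is valid, the leading orders of Hamilton's equations along the segment
   read pi_{-1} = m (qB - qA) and pi_{-1}' = m' pi_{-1}^2 / (2 m^2) = m' (qB - qA)^2 / 2,
   while differentiating the former gives pi_{-1}' = m' (qB - qA)^2; hence m' = 0.

   Conversely, for constant m the momentum can be eliminated and the equations become
   q'' = eps^2 F(q) with F = u0 u0' - V'/m.  For small eps the Dirichlet problem is solved
   by a contraction, and the expansion is obtained by bootstrapping: having an expansion up
   to O(eps^N), uniformly with all tau-derivatives, is preserved by q |-> F(q) and by double
   integration, and the factor eps^2 then improves its order. *)

(** * Derivatives on the unit interval *)

(** The momentum can be eliminated because the velocity terms cancel: for constant mass the first
    equation gives [p = m (q' / eps - u0 q)], and the term [u0' q'] from differentiating [u0 q] is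
    matched by the one from [u0' p] in the second equation, so F depends on the position alone. Four
    obstacles shape the construction. F is only locally Lipschitz, so the contraction runs with F
    cut off outside a ball that the solution turns out not to leave. Solutions are picked separately
    for each eps, with no regularity in eps, so every estimate is uniform in tau at fixed small eps
    and none compares two values of eps. The bootstrap yields coefficients for each N separately,
    whereas validity asks for one sequence serving all N; the coefficients are therefore read off
    canonically, as iterated limits of the solution. Finally [p] starts at order -1, so [eps * p] is
    expanded instead. The opposite direction uses only the truncation at N = 0, its remainder and
    the first tau-derivative of that remainder, in the limit eps -> 0+. *)

Definition deriv_on (f g : R -> R) : Prop :=
  forall t, unit_interval t -> D_in f g unit_interval t.

Lemma deriv_on_ext (f1 f2 g1 g2 : R -> R) :
  (forall t, unit_interval t -> f1 t = f2 t) ->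
  (forall t, unit_interval t -> g1 t = g2 t) ->
  deriv_on f1 g1 -> deriv_on f2 g2.
Proof.
  intros Hf Hg D t Ht e He.
  destruct (D t Ht e He) as [d [Hd D']].
  exists d; split; [exact Hd|].
  intros x Hx. specialize (D' x Hx).
  destruct Hx as [[Hx _] _].
  rewrite <- (Hf x Hx), <- (Hf t Ht), <- (Hg t Ht). exact D'.
Qed.

Lemma deriv_on_is_derive (f g : R -> R) :
  (forall t, unit_interval t -> is_derive f t (g t)) -> deriv_on f g.
Proof.
  intros D t Ht.
  specialize (D t Ht). apply is_derive_Reals, derivable_pt_lim_D_in in D.
  intros e He. destruct (D e He) as [d [Hd D']].
  exists d; split; [exact Hd|].
  intros x [[Hx Hne] Hxd]. apply D'. repeat split; assumption.
Qed.

Lemma deriv_on_const (c : R) : deriv_on (fun _ => c) (fun _ => 0).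
Proof. intros t _. apply Dconst. Qed.

Lemma deriv_on_plus (f g f' g' : R -> R) :
  deriv_on f f' -> deriv_on g g' ->
  deriv_on (fun t => f t + g t) (fun t => f' t + g' t).
Proof. intros Df Dg t Ht. apply Dadd; auto. Qed.

Lemma deriv_on_minus (f g f' g' : R -> R) :
  deriv_on f f' -> deriv_on g g' ->
  deriv_on (fun t => f t - g t) (fun t => f' t - g' t).
Proof. intros Df Dg t Ht. apply Dminus; auto. Qed.

Lemma deriv_on_mult (f g f' g' : R -> R) :
  deriv_on f f' -> deriv_on g g' ->
  deriv_on (fun t => f t * g t) (fun t => f' t * g t + f t * g' t).
Proof. intros Df Dg t Ht. apply Dmult; auto. Qed.

Lemma deriv_on_scal (c : R) (f f' : R -> R) :
  deriv_on f f' -> deriv_on (fun t => c * f t) (fun t => c * f' t).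
Proof. intros Df t Ht. apply Dmult_const; auto. Qed.

Lemma deriv_on_comp (F F' f f' : R -> R) :
  (forall x, is_derive F x (F' x)) -> deriv_on f f' ->
  deriv_on (fun t => F (f t)) (fun t => f' t * F' (f t)).
Proof.
  intros DF Df t Ht.
  assert (D : D_in F F' no_cond (f t))
    by (apply derivable_pt_lim_D_in, is_derive_Reals, DF).
  pose proof (Dcomp _ _ _ _ _ _ _ (Df t Ht) D) as DD.
  intros e He. destruct (DD e He) as [d [Hd D']].
  exists d; split; [exact Hd|].
  intros x [[Hx Hne] Hxd]. apply D'.
  split; [split; [split; [exact Hx|exact I]|exact Hne]|exact Hxd].
Qed.

(** A limit within the interval is unique because every point of it is an accumulation point: a step
    of length [b <= 1 / 2] towards the farther endpoint stays inside, however small [a] is. *)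
Lemma deriv_on_unique (f g1 g2 : R -> R) :
  deriv_on f g1 -> deriv_on f g2 ->
  forall t, unit_interval t -> g1 t = g2 t.
Proof.
  intros D1 D2 t Ht.
  refine (single_limit _ _ _ _ _ _ (D1 t Ht) (D2 t Ht)).
  intros a Ha. unfold unit_interval in Ht.
  set (b := Rmin a 1 / 2).
  assert (Hb : 0 < b <= 1 / 2 /\ b < a)
    by (unfold b, Rmin; destruct (Rle_dec a 1); lra).
  destruct (Rle_dec t (1/2)).
  - exists (t + b). split; [split; [unfold unit_interval; lra|lra]|].
    unfold Rdist. rewrite Rabs_right; lra.
  - exists (t - b). split; [split; [unfold unit_interval; lra|lra]|].
    unfold Rdist. rewrite Rabs_left; lra.
Qed.

(** The 1-Lipschitz retraction of the line onto [[a, b]]. It serves to extend functions from the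
    unit interval and, later, to cut off the force. *)
Definition clamp (a b x : R) : R := Rmax a (Rmin b x).

Lemma clamp_in (a b x : R) : a <= b -> a <= clamp a b x <= b.
Proof.
  intros. unfold clamp, Rmax, Rmin.
  repeat destruct Rle_dec; lra.
Qed.

Lemma clamp_id (a b x : R) : a <= x <= b -> clamp a b x = x.
Proof.
  intros. unfold clamp, Rmax, Rmin.
  repeat destruct Rle_dec; lra.
Qed.

Lemma clamp_lipschitz (a b x y : R) :
  Rabs (clamp a b x - clamp a b y) <= Rabs (x - y).
Proof.
  unfold clamp, Rmax, Rmin.
  repeat destruct Rle_dec; unfold Rabs; repeat destruct Rcase_abs; lra.
Qed.

Lemma lipschitz_continuous (f : R -> R) (L : R) :
  (forall x y, Rabs (f x - f y) <= L * Rabs (x - y)) ->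
  forall x, continuous f x.
Proof.
  intros Hf x. apply continuity_pt_filterlim.
  intros e He.
  (* [L] may be zero, or negative as far as the hypothesis shows; [Rabs L + 1] is safe to divide
     by. *)
  assert (HL : 0 < Rabs L + 1) by (pose proof (Rabs_pos L); lra).
  exists (e / (Rabs L + 1)). split; [apply Rdiv_lt_0_compat; lra|].
  intros y [_ Hy]. simpl in *. unfold Rdist in *.
  apply Rle_lt_trans with ((Rabs L + 1) * Rabs (y - x)).
  - eapply Rle_trans; [apply Hf|].
    apply Rmult_le_compat_r; [apply Rabs_pos|].
    pose proof (Rle_abs L); lra.
  - apply Rlt_le_trans with ((Rabs L + 1) * (e / (Rabs L + 1))).
    + apply Rmult_lt_compat_l; assumption.
    + right. field. lra.
Qed.

(* Precomposing with [clamp 0 1] turns one-sided continuity at the endpoints into continuity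
   on the whole line. *)
Lemma deriv_on_clamp_continuous (f g : R -> R) :
  deriv_on f g -> forall x, continuous (fun y => f (clamp 0 1 y)) x.
Proof.
  intros D x. apply continuity_pt_filterlim.
  assert (Hx := clamp_in 0 1 x Rle_0_1).
  pose proof (cont_deriv _ _ _ _ (D _ Hx)) as C.
  intros e He. destruct (C e He) as [d [Hd C']].
  exists d. split; [exact Hd|].
  intros y [_ Hy]. simpl in *. unfold Rdist in *.
  destruct (Req_dec (clamp 0 1 y) (clamp 0 1 x)) as [E|E].
  - rewrite E, Rminus_diag, Rabs_R0. exact He.
  - apply C'. split.
    + split; [apply clamp_in, Rle_0_1 | congruence].
    + eapply Rle_lt_trans; [apply clamp_lipschitz|exact Hy].
Qed.

(** At interior points a derivative within the interval is two-sided, and at the endpoints the mean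
    value theorem only wants continuity, which the clamped function has. *)
Lemma deriv_on_MVT (f g : R -> R) (x y : R) :
  deriv_on f g -> unit_interval x -> unit_interval y ->
  exists c, unit_interval c /\ f y - f x = g c * (y - x).
Proof.
  intros D Hx Hy. unfold unit_interval in Hx, Hy.
  assert (Hsub : forall z, Rmin x y <= z <= Rmax x y -> unit_interval z)
    by (intros z; unfold unit_interval, Rmin, Rmax; destruct Rle_dec; lra).
  destruct (MVT_gen (fun z => f (clamp 0 1 z)) x y g) as [c [Hc E]].
  - intros z Hz.
    assert (Hz' : 0 < z < 1).
    { revert Hz. unfold Rmin, Rmax. destruct Rle_dec; lra. }
    apply is_derive_ext_loc with f.
    { assert (P : 0 < Rmin z (1 - z)) by (apply Rmin_pos; lra).
      exists (mkposreal _ P). intros w Hw.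
      change (Rabs (w - z) < Rmin z (1 - z)) in Hw.
      rewrite clamp_id; [reflexivity|].
      revert Hw. unfold Rmin, Rabs. destruct Rle_dec, Rcase_abs; lra. }
    apply is_derive_Reals, derivable_pt_lim_D_in.
    intros e He.
    destruct (D z (conj (Rlt_le _ _ (proj1 Hz')) (Rlt_le _ _ (proj2 Hz'))) e He)
      as [d [Hd D']].
    exists (Rmin d (Rmin z (1 - z))). split.
    { apply Rmin_pos; [exact Hd|apply Rmin_pos; lra]. }
    intros w [[_ Hne] Hw]. simpl in *. unfold Rdist in *.
    apply D'. split.
    + split; [|exact Hne].
      revert Hw. unfold unit_interval, Rmin, Rabs.
      destruct Rle_dec, Rle_dec, Rcase_abs; lra.
    + eapply Rlt_le_trans; [exact Hw|apply Rmin_l].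
  - intros z _. apply continuity_pt_filterlim.
    apply (deriv_on_clamp_continuous f g D).
  - exists c. split; [apply Hsub, Hc|].
    rewrite !clamp_id in E; assumption.
Qed.

(** By the boundary values, [s] vanishes at some [c]; integrating [w] from [c] bounds [s], and
    integrating [s] from 0 bounds [d]. The interval has length 1, so the constant [M] is not
    enlarged. *)
Lemma dirichlet_bound (d s w : R -> R) (M : R) :
  deriv_on d s -> deriv_on s w -> d 0 = 0 -> d 1 = 0 ->
  (forall t, unit_interval t -> Rabs (w t) <= M) ->
  forall t, unit_interval t -> Rabs (s t) <= M /\ Rabs (d t) <= M.
Proof.
  intros Dd Ds d0 d1 Hw.
  assert (H0 : unit_interval 0) by (unfold unit_interval; lra).
  assert (H1 : unit_interval 1) by (unfold unit_interval; lra).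
  assert (HM : 0 <= M)
    by (eapply Rle_trans; [apply Rabs_pos|apply (Hw 0 H0)]).
  assert (Hdist : forall x y, unit_interval x -> unit_interval y ->
            Rabs (y - x) <= 1).
  { unfold unit_interval. intros x y Hx Hy. apply Rabs_le; lra. }
  destruct (deriv_on_MVT d s 0 1 Dd H0 H1) as [c [Hc Ec]].
  assert (sc : s c = 0) by lra.
  assert (Hs : forall t, unit_interval t -> Rabs (s t) <= M).
  { intros t Ht.
    destruct (deriv_on_MVT s w c t Ds Hc Ht) as [z [Hz Ez]].
    replace (s t) with (w z * (t - c)) by lra.
    rewrite Rabs_mult, <- (Rmult_1_r M).
    apply Rmult_le_compat; auto using Rabs_pos. }
  intros t Ht. split; [auto|].
  destruct (deriv_on_MVT d s 0 t Dd H0 Ht) as [z [Hz Ez]].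
  replace (d t) with (s z * (t - 0)) by lra.
  rewrite Rabs_mult, <- (Rmult_1_r M).
  apply Rmult_le_compat; auto using Rabs_pos.
Qed.

Definition prim (h : R -> R) (t : R) : R := RInt h 0 t.

Lemma is_derive_prim (h : R -> R) :
  (forall x, continuous h x) -> forall t, is_derive (prim h) t (h t).
Proof.
  intros Hh t. apply (is_derive_RInt h (prim h) 0); [|apply Hh].
  apply filter_forall. intros x.
  apply (RInt_correct (V := R_CompleteNormedModule)), ex_RInt_continuous.
  intros; apply Hh.
Qed.

(** The Green operator of the second derivative with zero boundary values: a double primitive,
    corrected by the linear function that restores the value 0 at 1. *)
Definition green (h : R -> R) (t : R) : R :=
  prim (prim h) t - t * prim (prim h) 1.

Definition green' (h : R -> R) (t : R) : R :=
  prim h t - prim (prim h) 1.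

Lemma green_spec (h : R -> R) :
  (forall x, continuous h x) ->
  (forall t, is_derive (green h) t (green' h t)) /\
  (forall t, is_derive (green' h) t (h t)) /\
  green h 0 = 0 /\ green h 1 = 0.
Proof.
  intros Hh.
  assert (Hp : forall x, continuous (prim h) x).
  { intros x. apply (ex_derive_continuous (prim h)).
    exists (h x). apply is_derive_prim, Hh. }
  split; [|split; [|split]].
  - intros t. apply (is_derive_minus (prim (prim h))); [apply is_derive_prim, Hp|].
    auto_derive; [exact I|ring].
  - intros t. rewrite <- (Rminus_0_r (h t)).
    apply (is_derive_minus (prim h)); [apply is_derive_prim, Hh|].
    auto_derive; [exact I|ring].
  - unfold green, prim at 1. rewrite RInt_point. unfold zero; simpl. lra.
  - unfold green. ring.
Qed.

(** * Uniform bounds on families *)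

(** Passes between the explicit thresholds of the definitions and the filter, under which finitely
    many smallness conditions combine without computing minima. *)
Lemma at_right_0_iff (P : R -> Prop) :
  at_right 0 P <-> exists d, 0 < d /\ forall e, 0 < e < d -> P e.
Proof.
  split.
  - intros [d H]. exists d. split; [apply cond_pos|].
    intros e He. apply H; [|lra].
    change (Rabs (e - 0) < d). rewrite Rabs_right; lra.
  - intros [d [Hd H]]. exists (mkposreal d Hd). intros e He H0.
    change (Rabs (e - 0) < d) in He. apply Rabs_def2 in He.
    apply H; lra.
Qed.

Lemma at_right_0_lt (d : R) : 0 < d -> at_right 0 (fun e => 0 < e < d).
Proof. intros Hd. apply at_right_0_iff. exists d; auto. Qed.

Definition sup_O (n : nat) (f : R -> R -> R) : Prop :=
  exists C, 0 <= C /\ at_right 0 (fun e => forall t, unit_interval t ->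
    Rabs (f e t) <= C * e ^ n).

Definition fam_deriv (f g : R -> R -> R) : Prop :=
  at_right 0 (fun e => deriv_on (f e) (g e)).

(** Families are compared only for small positive [e] and tau in the unit interval: elsewhere the
    solutions carry no information, and at 0 the divisions by [e] are meaningless. *)
Definition fam_eq (f g : R -> R -> R) : Prop :=
  at_right 0 (fun e => forall t, unit_interval t -> f e t = g e t).

(* [f] and its first [k] tau-derivatives are O(e^n); the constants may depend on the order
   of the derivative. *)
Fixpoint bigO (n k : nat) (f : R -> R -> R) : Prop :=
  sup_O n f /\
  match k with
  | O => True
  | S k' => exists g, fam_deriv f g /\ bigO n k' g
  end.

Lemma fam_eq_sym (f g : R -> R -> R) : fam_eq f g -> fam_eq g f.
Proof. apply (filter_imp (F := at_right 0)). intros e H t Ht. symmetry; auto. Qed.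

Lemma fam_eq_trans (f g h : R -> R -> R) :
  fam_eq f g -> fam_eq g h -> fam_eq f h.
Proof.
  intros H1 H2. generalize (filter_and (F := at_right 0) _ _ H1 H2).
  apply (filter_imp (F := at_right 0)).
  intros e [E1 E2] t Ht. rewrite E1; auto.
Qed.

Lemma fam_eq_all (f g : R -> R -> R) :
  (forall e t, 0 < e -> unit_interval t -> f e t = g e t) -> fam_eq f g.
Proof.
  intros H. generalize (at_right_0_lt 1 Rlt_0_1). apply (filter_imp (F := at_right 0)).
  intros e He t Ht. apply H; [lra|exact Ht].
Qed.

Lemma fam_deriv_all (f g : R -> R -> R) :
  (forall e, deriv_on (f e) (g e)) -> fam_deriv f g.
Proof. intros H. apply (filter_forall (F := at_right 0)), H. Qed.

Lemma sup_O_ext (n : nat) (f g : R -> R -> R) :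
  fam_eq f g -> sup_O n f -> sup_O n g.
Proof.
  intros E [C [HC H]]. exists C. split; [exact HC|].
  generalize (filter_and (F := at_right 0) _ _ E H). apply (filter_imp (F := at_right 0)).
  intros e [E' H'] t Ht. rewrite <- E'; auto.
Qed.

Lemma bigO_sup (n k : nat) (f : R -> R -> R) : bigO n k f -> sup_O n f.
Proof. destruct k; intros [H _]; exact H. Qed.

Lemma bigO_ext (n k : nat) (f g : R -> R -> R) :
  fam_eq f g -> bigO n k f -> bigO n k g.
Proof.
  intros E. destruct k as [|k]; intros [Hs H]; (split; [exact (sup_O_ext _ _ _ E Hs)|]);
    [exact I|].
  destruct H as [f' [D H]]. exists f'. split; [|exact H].
  generalize (filter_and (F := at_right 0) _ _ E D). apply (filter_imp (F := at_right 0)).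
  intros e [E' D']. revert D'. apply deriv_on_ext; auto.
Qed.

Lemma bigO_pred (n k : nat) (f : R -> R -> R) : bigO n (S k) f -> bigO n k f.
Proof.
  revert f. induction k as [|k IH]; intros f [Hs [f' [D H]]].
  - split; auto.
  - split; [exact Hs|]. exists f'. auto.
Qed.

Lemma bigO_plus (n k : nat) (f g : R -> R -> R) :
  bigO n k f -> bigO n k g -> bigO n k (fun e t => f e t + g e t).
Proof.
  revert f g. induction k as [|k IH]; intros f g [[C [HC Hf]] Hf'] [[D [HD Hg]] Hg'];
    (split; [exists (C + D); split; [lra|];
      generalize (filter_and (F := at_right 0) _ _ Hf Hg); apply (filter_imp (F := at_right 0));
      intros e [H1 H2] t Ht; specialize (H1 t Ht); specialize (H2 t Ht);
      eapply Rle_trans; [apply Rabs_triang|]; lra|]); [exact I|].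
  destruct Hf' as [f' [Df Hf']], Hg' as [g' [Dg Hg']].
  exists (fun e t => f' e t + g' e t). split; [|auto].
  generalize (filter_and (F := at_right 0) _ _ Df Dg). apply (filter_imp (F := at_right 0)).
  intros e [H1 H2]. apply deriv_on_plus; assumption.
Qed.

Lemma sup_O_mult (n j : nat) (f g : R -> R -> R) :
  sup_O n f -> sup_O j g -> sup_O (n + j) (fun e t => f e t * g e t).
Proof.
  intros [C [HC Hf]] [D [HD Hg]]. exists (C * D).
  split; [apply Rmult_le_pos; assumption|].
  generalize (filter_and (F := at_right 0) _ _ Hf Hg). apply (filter_imp (F := at_right 0)).
  intros e [H1 H2] t Ht. specialize (H1 t Ht). specialize (H2 t Ht).
  rewrite Rabs_mult, pow_add.
  replace (C * D * (e ^ n * e ^ j)) with ((C * e ^ n) * (D * e ^ j)) by ring.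
  apply Rmult_le_compat; auto using Rabs_pos.
Qed.

Lemma bigO_mult (n j k : nat) (f g : R -> R -> R) :
  bigO n k f -> bigO j k g -> bigO (n + j) k (fun e t => f e t * g e t).
Proof.
  revert f g. induction k as [|k IH]; intros f g Hf Hg;
    (split; [apply sup_O_mult; eapply bigO_sup; eassumption|]); [exact I|].
  assert (Hf0 := bigO_pred _ _ _ Hf). assert (Hg0 := bigO_pred _ _ _ Hg).
  destruct Hf as [_ [f' [Df Hf']]], Hg as [_ [g' [Dg Hg']]].
  exists (fun e t => f' e t * g e t + f e t * g' e t). split.
  - generalize (filter_and (F := at_right 0) _ _ Df Dg). apply (filter_imp (F := at_right 0)).
    intros e [H1 H2]. apply deriv_on_mult; assumption.
  - apply bigO_plus; apply IH; assumption.
Qed.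

Lemma bigO_zero (n k : nat) : bigO n k (fun _ _ => 0).
Proof.
  induction k as [|k IH]; (split; [exists 0; split; [lra|]; apply (filter_forall (F := at_right 0));
    intros e t _; rewrite Rabs_R0; lra|]); [exact I|].
  exists (fun _ _ => 0). split; [|exact IH].
  apply fam_deriv_all. intros e. apply deriv_on_const.
Qed.

Lemma bigO_monomial (n k : nat) (c : R) : bigO n k (fun e _ => c * e ^ n).
Proof.
  assert (Hs : sup_O n (fun e _ => c * e ^ n)).
  { exists (Rabs c). split; [apply Rabs_pos|].
    generalize (at_right_0_lt 1 Rlt_0_1). apply (filter_imp (F := at_right 0)).
    intros e He t _. rewrite Rabs_mult, (Rabs_right (e ^ n)); [lra|].
    apply Rle_ge, pow_le; lra. }
  destruct k as [|k]; (split; [exact Hs|]); [exact I|].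
  exists (fun _ _ => 0). split; [|apply bigO_zero].
  apply fam_deriv_all. intros e. apply deriv_on_const.
Qed.

Lemma bigO_const (k : nat) (c : R) : bigO 0 k (fun _ _ => c).
Proof.
  apply (bigO_ext _ _ (fun e _ => c * e ^ 0)); [|apply bigO_monomial].
  apply fam_eq_all; intros; simpl; ring.
Qed.

Lemma bigO_pow (n k j : nat) (f : R -> R -> R) :
  bigO n k f -> bigO (n * j) k (fun e t => f e t ^ j).
Proof.
  intros H. induction j as [|j IH].
  - rewrite Nat.mul_0_r. apply (bigO_const k 1).
  - replace (n * S j)%nat with (n + n * j)%nat by lia.
    exact (bigO_mult _ _ _ _ _ H IH).
Qed.

Lemma bigO_mult_eps (n k : nat) (f : R -> R -> R) :
  bigO n k f -> bigO (S n) k (fun e t => e * f e t).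
Proof.
  intros H. apply (bigO_mult 1 n); [|exact H].
  apply (bigO_ext _ _ (fun e _ => 1 * e ^ 1)); [|apply bigO_monomial].
  apply fam_eq_all; intros; ring.
Qed.

Lemma bigO_order_pred (n k : nat) (f : R -> R -> R) :
  bigO (S n) k f -> bigO n k f.
Proof.
  revert f. induction k as [|k IH]; intros f [[C [HC Hf]] H];
    (split; [exists C; split; [exact HC|];
       generalize (filter_and (F := at_right 0) _ _ Hf (at_right_0_lt 1 Rlt_0_1));
       apply (filter_imp (F := at_right 0));
       intros e [H1 He] t Ht; eapply Rle_trans; [apply H1, Ht|];
       apply Rmult_le_compat_l; [exact HC|]; simpl;
       rewrite <- (Rmult_1_l (e ^ n)) at 2; apply Rmult_le_compat_r;
       [apply pow_le|]; lra|]); [exact I|].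
  destruct H as [g [D H]]. exists g. auto.
Qed.

(** Since [e] does not depend on tau, dividing by it commutes with the derivatives: one order is
    lost, and no derivative. *)
Lemma bigO_div_eps (n k : nat) (f : R -> R -> R) :
  bigO (S n) k f -> bigO n k (fun e t => f e t / e).
Proof.
  revert f. induction k as [|k IH]; intros f [[C [HC Hf]] H];
    (split; [exists C; split; [exact HC|];
       generalize (filter_and (F := at_right 0) _ _ Hf (at_right_0_lt 1 Rlt_0_1));
       apply (filter_imp (F := at_right 0));
       intros e [H1 He] t Ht; unfold Rdiv; rewrite Rabs_mult, Rabs_inv, (Rabs_right e) by lra;
       apply Rle_div_l; [lra|]; eapply Rle_trans; [apply H1, Ht|]; simpl; lra|]); [exact I|].
  destruct H as [g [D H]]. exists (fun e t => g e t / e). split; [|auto].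
  revert D. apply (filter_imp (F := at_right 0)). intros e D.
  apply (deriv_on_ext (fun t => / e * f e t) _ (fun t => / e * g e t));
    [intros; unfold Rdiv; ring..|]. apply deriv_on_scal, D.
Qed.

(** [is_derive_n_on] peels off the outermost derivative and [bigO] the innermost one; this
    reconciles the two recursions. *)
Lemma is_derive_n_on_inner (D : R -> Prop) (f f' g : R -> R) (k : nat) :
  (forall x, D x -> D_in f f' D x) ->
  is_derive_n_on D f' k g -> is_derive_n_on D f (S k) g.
Proof.
  intros Hf. revert g. induction k as [|k IH]; intros g Hg.
  - exists f. split; [intros x _; reflexivity|]. intros x Hx. unfold D_in.
    (* [D_in] depends on its second function only through the value at [x]. *)
    rewrite (Hg x Hx). exact (Hf x Hx).
  - destruct Hg as [h [Hh Hg]]. exists h. split; [apply IH, Hh|exact Hg].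
Qed.

Lemma bigO_derive_n (n k : nat) (f : R -> R -> R) :
  bigO n k f -> exists C, at_right 0 (fun e =>
    exists g, is_derive_n_on unit_interval (f e) k g /\
      forall t, unit_interval t -> Rabs (g t) <= C * e ^ n).
Proof.
  revert f. induction k as [|k IH]; intros f Hf.
  - destruct Hf as [[C [_ H]] _]. exists C. revert H. apply (filter_imp (F := at_right 0)).
    intros e H. exists (f e). split; [intros x _; reflexivity|exact H].
  - destruct Hf as [_ [f' [D Hf]]]. destruct (IH f' Hf) as [C H].
    exists C. generalize (filter_and (F := at_right 0) _ _ D H).
    apply (filter_imp (F := at_right 0)).
    intros e [De [g [Hg Hb]]]. exists g. split; [|exact Hb].
    eapply is_derive_n_on_inner; [exact De|exact Hg].
Qed.

Lemma bigO_uniform_remainder (n : nat) (f : R -> R -> R) :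
  (forall k, bigO n k f) -> uniform_remainder f n.
Proof.
  intros H k. destruct (bigO_derive_n n k f (H k)) as [C HC].
  apply at_right_0_iff in HC. destruct HC as [d [Hd HC]].
  exists C, d. auto.
Qed.

(** Smoothness phrased through constant families, so that the closure properties of [bigO] apply to
    coefficients as well as to remainders. *)
Definition smooth_unit (a : R -> R) : Prop := forall k, bigO 0 k (fun _ => a).

Lemma smooth_unit_smooth_on (a : R -> R) :
  smooth_unit a -> smooth_on unit_interval a.
Proof.
  intros H k. destruct (bigO_derive_n 0 k _ (H k)) as [C HC].
  apply at_right_0_iff in HC. destruct HC as [d [Hd HC]].
  (* The family does not depend on [e], so any sample below the threshold will do. *)
  destruct (HC (d / 2)) as [g [Hg _]]; [lra|]. exists g; exact Hg.
Qed.

Lemma smooth_unit_ext (a b : R -> R) :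
  (forall t, unit_interval t -> a t = b t) -> smooth_unit a -> smooth_unit b.
Proof.
  intros E H k. refine (bigO_ext _ _ _ _ _ (H k)). apply fam_eq_all; auto.
Qed.

Lemma smooth_unit_deriv_intro (a b : R -> R) :
  deriv_on a b -> smooth_unit b -> smooth_unit a.
Proof.
  intros D H k. assert (Hs : sup_O 0 (fun _ : R => a)).
  { destruct (bigO_sup _ _ _ (H 0%nat)) as [C [HC HS]].
    apply at_right_0_iff in HS. destruct HS as [d [Hd HS]].
    exists (Rabs (a 0) + C). split; [pose proof (Rabs_pos (a 0)); lra|].
    apply (filter_forall (F := at_right 0)). intros e t Ht.
    assert (H0 : unit_interval 0) by (unfold unit_interval; lra).
    destruct (deriv_on_MVT a b 0 t D H0 Ht) as [z [Hz Ez]].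
    replace (a t) with (a 0 + b z * (t - 0)) by lra.
    rewrite Rmult_1_r. eapply Rle_trans; [apply Rabs_triang|].
    apply Rplus_le_compat_l. rewrite Rabs_mult, <- (Rmult_1_r C).
    apply Rmult_le_compat; try apply Rabs_pos.
    - specialize (HS (d / 2) ltac:(lra) z Hz). simpl in HS. lra.
    - unfold unit_interval in Ht. apply Rabs_le; lra. }
  destruct k as [|k]; (split; [exact Hs|]); [exact I|].
  exists (fun _ => b). split; [apply fam_deriv_all; auto|apply H].
Qed.

Lemma smooth_unit_deriv (a : R -> R) :
  smooth_unit a -> exists b, deriv_on a b.
Proof.
  intros H. destruct (H 1%nat) as [_ [g [D _]]].
  apply at_right_0_iff in D. destruct D as [d [Hd D]].
  exists (g (d / 2)). apply D. lra.
Qed.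

Lemma smooth_ex_derive (F : R -> R) : smooth F -> forall x, ex_derive F x.
Proof. intros H x. exact (H 1%nat x). Qed.

Lemma smooth_is_derive (F : R -> R) :
  smooth F -> forall x, is_derive F x (Derive F x).
Proof. intros H x. apply Derive_correct, smooth_ex_derive, H. Qed.

Lemma Derive_n_Derive (F : R -> R) (n : nat) (x : R) :
  Derive_n (Derive F) n x = Derive_n F (S n) x.
Proof.
  replace (S n) with (n + 1)%nat by lia.
  rewrite <- (Derive_n_comp F n 1). reflexivity.
Qed.

Lemma smooth_Derive (F : R -> R) : smooth F -> smooth (Derive F).
Proof.
  intros H [|n] x; [exact I|].
  apply ex_derive_ext with (Derive_n F (S n)); [|exact (H (S (S n)) x)].
  intros t. symmetry. apply Derive_n_Derive.
Qed.

Lemma smooth_Derive_n (F : R -> R) (n : nat) : smooth F -> smooth (Derive_n F n).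
Proof. intros H. induction n; [exact H|]. apply smooth_Derive, IHn. Qed.

Lemma smooth_bounded (F : R -> R) (r : R) :
  smooth F -> exists M, 0 <= M /\ forall x, Rabs x <= r -> Rabs (F x) <= M.
Proof.
  intros H. destruct (Rle_dec 0 r) as [Hr|Hr].
  - destruct (continuity_ab_maj (fun x => Rabs (F x)) (- r) r) as [z [Hz _]].
    + lra.
    + intros c _. apply (continuity_pt_comp F Rabs); [|apply Rcontinuity_abs].
      apply continuity_pt_filterlim, (ex_derive_continuous F), smooth_ex_derive, H.
    + exists (Rabs (F z)). split; [apply Rabs_pos|].
      intros x Hx. apply Hz. apply Rabs_le_between. exact Hx.
  - exists 0. split; [lra|]. intros x Hx. pose proof (Rabs_pos x). lra.
Qed.

(** The chain rule replaces [F] by [Derive F], so the induction on [k] runs over all smooth [F] at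
    once. *)
Lemma bigO_comp (F : R -> R) (k : nat) (q : R -> R -> R) :
  smooth F -> bigO 0 k q -> bigO 0 k (fun e t => F (q e t)).
Proof.
  revert F q. induction k as [|k IH]; intros F q HF Hq;
    (split; [destruct (bigO_sup _ _ _ Hq) as [C [HC Hs]];
      destruct (smooth_bounded F C HF) as [M [HM HFM]]; exists M; split; [exact HM|];
      revert Hs; apply (filter_imp (F := at_right 0)); intros e Hs t Ht; simpl; rewrite Rmult_1_r;
      apply HFM; specialize (Hs t Ht); simpl in Hs; lra|]); [exact I|].
  assert (Hq0 := bigO_pred _ _ _ Hq).
  destruct Hq as [_ [q' [D Hq']]].
  exists (fun e t => q' e t * Derive F (q e t)). split.
  - revert D. apply (filter_imp (F := at_right 0)). intros e D.
    apply deriv_on_comp; [apply smooth_is_derive, HF|exact D].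
  - apply (bigO_mult 0 0); [exact Hq'|]. apply IH; [apply smooth_Derive, HF|exact Hq0].
Qed.

(** * Asymptotic expansions *)

Definition taylor_coef (F : R -> R) (n : nat) (y : R) : R :=
  Derive_n F n y / INR (fact n).

(** [F x] minus the Taylor polynomial at [y] with [n] terms, of degree [n - 1]. Subtracting one term
    per step suits the inductions below. *)
Fixpoint taylor_rem (F : R -> R) (n : nat) (x y : R) : R :=
  match n with
  | O => F x
  | S n' => taylor_rem F n' x y - taylor_coef F n' y * (x - y) ^ n'
  end.

Lemma taylor_coef_Derive (F : R -> R) (n : nat) (y : R) :
  INR (S n) * taylor_coef F (S n) y = taylor_coef (Derive F) n y.
Proof.
  unfold taylor_coef. rewrite Derive_n_Derive, fact_simpl, mult_INR.
  field. split; [apply INR_fact_neq_0|apply not_0_INR; lia].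
Qed.

Lemma smooth_taylor_coef (F : R -> R) (n : nat) :
  smooth F -> smooth (taylor_coef F n).
Proof.
  intros H k x.
  apply ex_derive_n_ext with (fun y => / INR (fact n) * Derive_n F n y).
  { intros t. unfold taylor_coef, Rdiv. ring. }
  apply ex_derive_n_scal_l, smooth_Derive_n, H.
Qed.

Lemma Derive_taylor_coef (F : R -> R) (n : nat) (y : R) :
  Derive (taylor_coef F n) y = taylor_coef (Derive F) n y.
Proof.
  unfold taylor_coef. rewrite Derive_n_Derive.
  rewrite (Derive_ext _ (fun y => / INR (fact n) * Derive_n F n y))
    by (intros; unfold Rdiv; ring).
  rewrite Derive_scal. simpl. unfold Rdiv. ring.
Qed.

Lemma is_derive_taylor_rem (F : R -> R) (n : nat) (x y : R) :
  smooth F ->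
  is_derive (fun x => taylor_rem F (S n) x y) x (taylor_rem (Derive F) n x y).
Proof.
  intros HF. induction n as [|n IH].
  - apply (is_derive_ext (fun x => F x - taylor_coef F 0 y)).
    { intros z. change (F z - taylor_coef F 0 y = F z - taylor_coef F 0 y * 1). ring. }
    change (is_derive (fun x => F x - taylor_coef F 0 y) x (Derive F x)).
    rewrite <- (Rminus_0_r (Derive F x)).
    apply (is_derive_minus F (fun _ => taylor_coef F 0 y)).
    + apply smooth_is_derive, HF.
    + apply (is_derive_const (taylor_coef F 0 y)).
  - change (taylor_rem (Derive F) (S n) x y)
      with (minus (taylor_rem (Derive F) n x y) (taylor_coef (Derive F) n y * (x - y) ^ n)).
    apply (is_derive_minus (fun x => taylor_rem F (S n) x y)
             (fun x => taylor_coef F (S n) y * (x - y) ^ S n)); [exact IH|].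
    rewrite <- taylor_coef_Derive.
    auto_derive; [exact I|].
    change (match n with O => 1 | S _ => INR n + 1 end) with (INR (S n)).
    unfold Rminus. ring.
Qed.

Lemma taylor_rem_diag (F : R -> R) (n : nat) (x : R) : taylor_rem F (S n) x x = 0.
Proof.
  induction n as [|n IH].
  - simpl. unfold taylor_coef. simpl. field.
  - change (taylor_rem F (S n) x x - taylor_coef F (S n) x * (x - x) ^ S n = 0).
    rewrite IH, Rminus_diag. simpl. ring.
Qed.

(** The remainder vanishes at [x = y] and its [x]-derivative is the remainder of [Derive F] with one
    term less, so each mean value step gains a factor [Rabs (x - y)]. The [M] obtained bounds the
    n-th derivative on the ball; the factor 1/n! is given up. *)
Lemma taylor_rem_bound (F : R -> R) (n : nat) (r : R) :
  smooth F -> exists M, 0 <= M /\ forall x y, Rabs x <= r -> Rabs y <= r ->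
    Rabs (taylor_rem F n x y) <= M * Rabs (x - y) ^ n.
Proof.
  revert F. induction n as [|n IH]; intros F HF.
  - destruct (smooth_bounded F r HF) as [M [HM H]]. exists M. split; [exact HM|].
    intros x y Hx _. simpl. rewrite Rmult_1_r. auto.
  - destruct (IH _ (smooth_Derive F HF)) as [M [HM H]]. exists M. split; [exact HM|].
    intros x y Hx Hy.
    destruct (MVT_gen (fun x => taylor_rem F (S n) x y) y x
               (fun x => taylor_rem (Derive F) n x y)) as [c [Hc E]].
    + intros; apply is_derive_taylor_rem, HF.
    + intros z _. apply continuity_pt_filterlim,
        (ex_derive_continuous (fun x => taylor_rem F (S n) x y)).
      eexists. apply is_derive_taylor_rem, HF.
    + rewrite taylor_rem_diag, Rminus_0_r in E. rewrite E, Rabs_mult.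
      apply Rabs_le_between in Hx, Hy.
      assert (Hcy : Rabs (c - y) <= Rabs (x - y)).
      { revert Hc. unfold Rmin, Rmax, Rabs.
        repeat destruct Rle_dec; repeat destruct Rcase_abs; lra. }
      assert (Hcr : Rabs c <= r).
      { apply Rabs_le. revert Hc. unfold Rmin, Rmax. repeat destruct Rle_dec; lra. }
      simpl pow. rewrite (Rmult_comm (Rabs (x - y))), <- Rmult_assoc.
      apply Rmult_le_compat_r; [apply Rabs_pos|].
      eapply Rle_trans; [apply H; [exact Hcr|apply Rabs_le_between, Hy]|].
      apply Rmult_le_compat_l; [exact HM|].
      apply pow_incr. split; [apply Rabs_pos|exact Hcy].
Qed.

(** Differentiating the Taylor polynomial in its base point telescopes, leaving only the last term,
    of degree [n] in [x - y]. *)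
Lemma deriv_on_taylor_rem (F : R -> R) (n : nat) (x y x' y' : R -> R) :
  smooth F -> deriv_on x x' -> deriv_on y y' ->
  deriv_on (fun t => taylor_rem F (S n) (x t) (y t))
    (fun t => x' t * taylor_rem (Derive F) n (x t) (y t)
              - y' t * taylor_coef (Derive F) n (y t) * (x t - y t) ^ n).
Proof.
  intros HF Dx Dy.
  assert (Dc : forall j, deriv_on (fun t => taylor_coef F j (y t))
                (fun t => y' t * taylor_coef (Derive F) j (y t))).
  { intros j.
    refine (deriv_on_ext _ _ _ _ (fun _ _ => eq_refl) _
      (deriv_on_comp _ _ _ _ (smooth_is_derive _ (smooth_taylor_coef F j HF)) Dy)).
    intros t _. simpl. rewrite Derive_taylor_coef. reflexivity. }
  assert (Dp : forall j, deriv_on (fun t => (x t - y t) ^ S j)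
                (fun t => (x' t - y' t) * (INR (S j) * (x t - y t) ^ j))).
  { intros j.
    apply (deriv_on_comp (fun z => z ^ S j) (fun z => INR (S j) * z ^ j)
             (fun t => x t - y t) (fun t => x' t - y' t)).
    - intros z. auto_derive; [exact I|].
      change (match j with O => 1 | S _ => INR j + 1 end) with (INR (S j)). ring.
    - apply deriv_on_minus; assumption. }
  induction n as [|n IH].
  - simpl.
    refine (deriv_on_ext _ _ _ _ _ _
      (deriv_on_minus _ _ _ _
        (deriv_on_comp _ _ _ _ (smooth_is_derive _ HF) Dx) (Dc 0%nat)));
      intros t _; simpl; ring.
  - refine (deriv_on_ext _ _ _ _ _ _
      (deriv_on_minus _ _ _ _ IH (deriv_on_mult _ _ _ _ (Dc (S n)) (Dp n))));
      intros t _; [reflexivity|].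
    rewrite <- (taylor_coef_Derive F n).
    simpl taylor_rem. rewrite <- (taylor_coef_Derive F n). simpl pow. ring.
Qed.

Lemma bigO_eps_add (n k : nat) (q g : R -> R -> R) :
  bigO n k q -> bigO n k g -> bigO n k (fun e t => q e t + e * g e t).
Proof.
  intros Hq Hg. apply bigO_plus; [exact Hq|].
  apply bigO_order_pred, bigO_mult_eps, Hg.
Qed.

(* The tau-derivative of a Taylor remainder of [F] is again made of Taylor remainders, of
   [Derive F] and of the same order. *)
Lemma bigO_taylor_rem (F : R -> R) (n k : nat) (q g : R -> R -> R) :
  smooth F -> bigO 0 k q -> bigO 0 k g ->
  bigO n k (fun e t => taylor_rem F n (q e t + e * g e t) (q e t)).
Proof.
  revert F q g. induction k as [|k IH]; intros F q g HF Hq Hg.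
  - split; [|exact I].
    destruct (bigO_sup _ _ _ Hq) as [C1 [HC1 H1]].
    destruct (bigO_sup _ _ _ Hg) as [C2 [HC2 H2]].
    destruct (bigO_sup _ _ _ (bigO_eps_add _ _ _ _ Hq Hg)) as [C3 [HC3 H3]].
    (* [C1 + C3] is a common radius for both arguments of the remainder; their difference is
       [e * g], whence the constant [M * C2 ^ n]. *)
    destruct (taylor_rem_bound F n (C1 + C3) HF) as [M [HM H]].
    exists (M * C2 ^ n). split; [apply Rmult_le_pos, pow_le; assumption|].
    generalize (filter_and (F := at_right 0) _ _ (at_right_0_lt 1 Rlt_0_1)
      (filter_and (F := at_right 0) _ _ H1 (filter_and (F := at_right 0) _ _ H2 H3))).
    apply (filter_imp (F := at_right 0)).
    intros e [He [B1 [B2 B3]]] t Ht.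
    specialize (B1 t Ht). specialize (B2 t Ht). specialize (B3 t Ht).
    simpl in B1, B2, B3. rewrite Rmult_1_r in B1, B2, B3.
    eapply Rle_trans; [apply H; lra|].
    rewrite Rmult_assoc. apply Rmult_le_compat_l; [exact HM|].
    rewrite <- Rpow_mult_distr. apply pow_incr. split; [apply Rabs_pos|].
    replace (q e t + e * g e t - q e t) with (g e t * e) by ring.
    rewrite Rabs_mult, (Rabs_right e) by lra.
    apply Rmult_le_compat_r; lra.
  - assert (Hx := bigO_eps_add _ _ _ _ Hq Hg).
    destruct n as [|n]; [apply (bigO_comp F _ _ HF Hx)|].
    assert (Hq0 := bigO_pred _ _ _ Hq). assert (Hg0 := bigO_pred _ _ _ Hg).
    split; [exact (bigO_sup _ _ _ (IH F q g HF Hq0 Hg0))|].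
    destruct Hq as [_ [q' [Dq Hq']]], Hg as [_ [g' [Dg Hg']]].
    (* The derivative formula gives a remainder of [Derive F] with only [n] terms subtracted.
       Subtracting one more term cancels the part of the boundary term carrying [q']; what is left
       has the factor [e * g'], so both summands have order [S n]. *)
    exists (fun e t => (q' e t + e * g' e t) *
                taylor_rem (Derive F) (S n) (q e t + e * g e t) (q e t)
              + e * (g' e t * taylor_coef (Derive F) n (q e t) *
                     (e * g e t) ^ n)).
    split.
    + generalize (filter_and (F := at_right 0) _ _ Dq Dg).
      apply (filter_imp (F := at_right 0)). intros e [D1 D2].
      refine (deriv_on_ext _ _ _ _ (fun _ _ => eq_refl) _
        (deriv_on_taylor_rem F n _ _ _ _ HF
          (deriv_on_plus _ _ _ _ D1 (deriv_on_scal e _ _ D2)) D1)).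
      intros t _. simpl.
      replace (q e t + e * g e t - q e t) with (e * g e t) by ring. ring.
    + apply bigO_plus.
      * apply (bigO_mult 0 (S n)); [apply bigO_eps_add; assumption|].
        apply IH; auto using smooth_Derive.
      * apply bigO_mult_eps. apply (bigO_mult 0 n).
        -- apply (bigO_mult 0 0); [exact Hg'|].
           apply bigO_comp; [apply smooth_taylor_coef, smooth_Derive, HF|exact Hq0].
        -- rewrite <- (Nat.mul_1_l n) at 1.
           apply bigO_pow, bigO_mult_eps, Hg0.
Qed.

(* [f = a_0 + e (a_1 + e (... + e g))] with [N] coefficients, the remainder [g] being bounded
   with all its derivatives.  The nested form makes products and composition inductive in
   [N], with no Cauchy products. *)
Fixpoint expands (N : nat) (f : R -> R -> R) : Prop :=
  match N with
  | O => forall k, bigO 0 k f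
  | S N' => exists a g, smooth_unit a /\ expands N' g /\
              fam_eq f (fun e t => a t + e * g e t)
  end.

Lemma expands_ext (N : nat) (f g : R -> R -> R) :
  fam_eq f g -> expands N f -> expands N g.
Proof.
  intros E. destruct N as [|N].
  - intros H k. exact (bigO_ext _ _ _ _ E (H k)).
  - intros [a [h [Ha [Hh Eh]]]]. exists a, h. split; [exact Ha|].
    split; [exact Hh|].
    exact (fam_eq_trans _ _ _ (fam_eq_sym _ _ E) Eh).
Qed.

Lemma smooth_unit_const (c : R) : smooth_unit (fun _ => c).
Proof. intros k. apply bigO_const. Qed.

(** All coefficients are zero, and each of them uses up one order of smallness through a division by
    [e]. *)
Lemma expands_of_bigO (N : nat) (f : R -> R -> R) :
  (forall k, bigO N k f) -> expands N f.
Proof.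
  revert f. induction N as [|N IH]; intros f H; [exact H|].
  exists (fun _ => 0), (fun e t => f e t / e). split; [apply smooth_unit_const|].
  split; [apply IH; intros k; apply bigO_div_eps, H|].
  apply fam_eq_all. intros e t He _. field. lra.
Qed.

Lemma expands_smooth (N : nat) (a : R -> R) :
  smooth_unit a -> expands N (fun _ => a).
Proof.
  intros Ha. destruct N as [|N]; [exact Ha|].
  exists a, (fun _ _ => 0). split; [exact Ha|].
  split; [apply expands_of_bigO; intros k; apply bigO_zero|].
  apply fam_eq_all. intros; ring.
Qed.

Lemma expands_plus (N : nat) (f g : R -> R -> R) :
  expands N f -> expands N g -> expands N (fun e t => f e t + g e t).
Proof.
  revert f g. induction N as [|N IH]; intros f g.
  - intros Hf Hg k. apply bigO_plus; auto.
  - intros [a [f1 [Ha [Hf Ef]]]] [b [g1 [Hb [Hg Eg]]]].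
    exists (fun t => a t + b t), (fun e t => f1 e t + g1 e t).
    split; [intros k; apply bigO_plus; auto|]. split; [auto|].
    generalize (filter_and (F := at_right 0) _ _ Ef Eg).
    apply (filter_imp (F := at_right 0)). intros e [E1 E2] t Ht.
    rewrite E1, E2 by exact Ht. ring.
Qed.

Lemma expands_mult_eps (N : nat) (f : R -> R -> R) :
  expands N f -> expands (S N) (fun e t => e * f e t).
Proof.
  intros H. exists (fun _ => 0), f. split; [apply smooth_unit_const|].
  split; [exact H|]. apply fam_eq_all; intros; ring.
Qed.

Lemma expands_pred (N : nat) (f : R -> R -> R) : expands (S N) f -> expands N f.
Proof.
  revert f. induction N as [|N IH]; intros f [a [g [Ha [Hg E]]]].
  - intros k. apply (bigO_ext _ _ _ _ (fam_eq_sym _ _ E)).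
    exact (bigO_eps_add _ _ _ _ (Ha k) (Hg k)).
  - exists a, g. auto.
Qed.

Lemma expands_bigO (N k : nat) (f : R -> R -> R) : expands N f -> bigO 0 k f.
Proof.
  intros H. revert k. change (expands 0 f).
  induction N as [|N IH]; [exact H|apply IH, expands_pred, H].
Qed.

Lemma expands_mult (N : nat) (f g : R -> R -> R) :
  expands N f -> expands N g -> expands N (fun e t => f e t * g e t).
Proof.
  revert f g. induction N as [|N IH]; intros f g.
  - intros Hf Hg k. apply (bigO_mult 0 0); auto.
  - intros [a [f1 [Ha [Hf Ef]]]] [b [g1 [Hb [Hg Eg]]]].
    exists (fun t => a t * b t),
      (fun e t => a t * g1 e t + b t * f1 e t + e * (f1 e t * g1 e t)).
    split; [intros k; apply (bigO_mult 0 0); auto|].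
    split.
    + apply expands_plus; [apply expands_plus|].
      * apply (IH (fun _ => a)); [apply expands_smooth, Ha|exact Hg].
      * apply (IH (fun _ => b)); [apply expands_smooth, Hb|exact Hf].
      * apply expands_pred, expands_mult_eps. auto.
    + generalize (filter_and (F := at_right 0) _ _ Ef Eg).
      apply (filter_imp (F := at_right 0)). intros e [E1 E2] t Ht.
      rewrite E1, E2 by exact Ht. ring.
Qed.

Lemma expands_scal (N : nat) (c : R) (f : R -> R -> R) :
  expands N f -> expands N (fun e t => c * f e t).
Proof.
  intros H. apply (expands_mult N (fun _ _ => c)); [|exact H].
  apply (expands_smooth N (fun _ => c)), smooth_unit_const.
Qed.

Lemma expands_pow (N j : nat) (f : R -> R -> R) :
  expands N f -> expands N (fun e t => f e t ^ j).
Proof.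
  intros H. induction j as [|j IH].
  - apply (expands_smooth N (fun _ => 1)), smooth_unit_const.
  - exact (expands_mult _ _ _ H IH).
Qed.

(** From [N] coefficients of [g] come [N + 1] of the composite, because [g] enters with a factor
    [e]; this gain drives the bootstrap. The Taylor remainder at [a] with [S N] terms subtracted is
    O(e^(S N)), and the subtracted terms are powers of [e * g]. *)
Lemma expands_comp (F : R -> R) (N : nat) (a : R -> R) (g : R -> R -> R) :
  smooth F -> smooth_unit a -> expands N g ->
  expands (S N) (fun e t => F (a t + e * g e t)).
Proof.
  intros HF Ha Hg.
  assert (Hc : forall n, smooth_unit (fun t => taylor_coef F n (a t))).
  { intros n k. apply (bigO_comp (taylor_coef F n) k (fun _ => a));
      [apply smooth_taylor_coef, HF|apply Ha]. }
  (* The subtracted terms are added back one at a time; with none subtracted, the remainder is the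
     composite itself. *)
  assert (Hn : forall n,
    expands (S N) (fun e t => taylor_rem F n (a t + e * g e t) (a t)) ->
    expands (S N) (fun e t => F (a t + e * g e t))).
  { induction n as [|n IH]; [auto|]. intros H. apply IH.
    apply (expands_ext _ (fun e t => taylor_rem F (S n) (a t + e * g e t) (a t)
             + taylor_coef F n (a t) * (e * g e t) ^ n)).
    - apply fam_eq_all. intros e t _ _. simpl.
      replace (a t + e * g e t - a t) with (e * g e t) by ring. ring.
    - apply expands_plus; [exact H|].
      apply (expands_mult _ (fun _ t => taylor_coef F n (a t))).
      + apply (expands_smooth _ (fun t => taylor_coef F n (a t))), Hc.
      + apply expands_pow, expands_mult_eps, Hg. }
  apply (Hn (S N)), expands_of_bigO. intros k.
  apply (bigO_taylor_rem F (S N) k (fun _ => a)); [exact HF|apply Ha|].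
  exact (expands_bigO _ _ _ Hg).
Qed.

(** * The Dirichlet problem *)

Lemma le_add_geometric (a b c : R) :
  (forall n, a <= b + c * (1 / 2) ^ n) -> a <= b.
Proof.
  intros H.
  apply (is_lim_seq_le (fun _ => a) (fun n => b + c * (1 / 2) ^ n) a b H).
  - apply is_lim_seq_const.
  - replace (Finite b) with (Finite (b + c * 0)) by (f_equal; ring).
    apply is_lim_seq_plus'; [apply is_lim_seq_const|].
    apply (is_lim_seq_scal_l _ c 0), is_lim_seq_geom. rewrite Rabs_right; lra.
Qed.

(** The intervals of radius [2 * (1 / 2) ^ n] about [u n] are nested, the radius being the sum of
    all later steps; [l] is the supremum of their left ends. *)
Lemma geometric_limit (u : nat -> R) :
  (forall n, Rabs (u (S n) - u n) <= (1 / 2) ^ n) ->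
  exists l, forall n, Rabs (l - u n) <= 2 * (1 / 2) ^ n.
Proof.
  intros H.
  assert (Hv : forall n p, u n - 2 * (1 / 2) ^ n <= u (n + p)%nat - 2 * (1 / 2) ^ (n + p)).
  { intros n p. induction p as [|p IH]; [rewrite Nat.add_0_r; lra|].
    rewrite Nat.add_succ_r. specialize (H (n + p)%nat).
    apply Rabs_le_between in H. simpl. lra. }
  assert (Hw : forall n p, u (n + p)%nat + 2 * (1 / 2) ^ (n + p) <= u n + 2 * (1 / 2) ^ n).
  { intros n p. induction p as [|p IH]; [rewrite Nat.add_0_r; lra|].
    rewrite Nat.add_succ_r. specialize (H (n + p)%nat).
    apply Rabs_le_between in H. simpl. lra. }
  assert (Hvw : forall n m, u n - 2 * (1 / 2) ^ n <= u m + 2 * (1 / 2) ^ m).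
  { intros n m. eapply Rle_trans; [apply (Hv n m)|].
    eapply Rle_trans; [|apply (Hw m n)]. rewrite (Nat.add_comm m n).
    assert (0 <= (1 / 2) ^ (n + m)) by (apply pow_le; lra). lra. }
  destruct (completeness (fun x => exists n, x = u n - 2 * (1 / 2) ^ n)) as [l [Hl1 Hl2]].
  - exists (u 0%nat + 2 * (1 / 2) ^ 0). intros x [n ->]. apply Hvw.
  - exists (u 0%nat - 2 * (1 / 2) ^ 0). exists 0%nat. reflexivity.
  - exists l. intros n. apply Rabs_le.
    assert (u n - 2 * (1 / 2) ^ n <= l) by (apply Hl1; exists n; reflexivity).
    assert (l <= u n + 2 * (1 / 2) ^ n) by (apply Hl2; intros x [m ->]; apply Hvw).
    lra.
Qed.

Lemma deriv_on_segment (qA qB : R) : deriv_on (segment qA qB) (fun _ => qB - qA).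
Proof.
  apply deriv_on_is_derive. intros t _. unfold segment. auto_derive; [exact I|ring].
Qed.

Lemma green_deriv_on (h : R -> R) :
  (forall x, continuous h x) ->
  deriv_on (green h) (green' h) /\ deriv_on (green' h) h.
Proof.
  intros Hh. destruct (green_spec h Hh) as [D1 [D2 _]].
  split; apply deriv_on_is_derive; auto.
Qed.

Lemma green_bound (h : R -> R) (M : R) :
  (forall x, continuous h x) -> (forall t, unit_interval t -> Rabs (h t) <= M) ->
  forall t, unit_interval t -> Rabs (green' h t) <= M /\ Rabs (green h t) <= M.
Proof.
  intros Hh HM. destruct (green_spec h Hh) as [_ [_ [E0 E1]]].
  destruct (green_deriv_on h Hh) as [D1 D2].
  exact (dirichlet_bound _ _ _ M D1 D2 E0 E1 HM).
Qed.

Lemma green_diff_bound (h1 h2 : R -> R) (M : R) :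
  (forall x, continuous h1 x) -> (forall x, continuous h2 x) ->
  (forall t, unit_interval t -> Rabs (h1 t - h2 t) <= M) ->
  forall t, unit_interval t -> Rabs (green h1 t - green h2 t) <= M.
Proof.
  intros C1 C2 HM t Ht.
  destruct (green_spec h1 C1) as [_ [_ [E0 E1]]].
  destruct (green_spec h2 C2) as [_ [_ [E0' E1']]].
  destruct (green_deriv_on h1 C1) as [D1 D2].
  destruct (green_deriv_on h2 C2) as [D1' D2'].
  apply (dirichlet_bound (fun t => green h1 t - green h2 t)
    (fun t => green' h1 t - green' h2 t) (fun t => h1 t - h2 t) M);
    [apply deriv_on_minus; assumption..|lra|lra|exact HM|exact Ht].
Qed.

(** Iteration for q'' = lam G(q) in its integral form. The segment carries the boundary values and
    [green] contributes zero there. *)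
Fixpoint picard (G : R -> R) (lam qA qB : R) (n : nat) (t : R) : R :=
  match n with
  | O => segment qA qB t
  | S n' => segment qA qB t + lam * green (fun x => G (picard G lam qA qB n' x)) t
  end.

(** [green] has sup norm at most 1, so [lam_L] makes the iteration contract by one half, while
    [lam_M] bounds the first step by 1 and keeps the solution within distance 1 of the segment. *)
Section BoundaryValueProblem.
Variables (G : R -> R) (L M lam qA qB : R).
Hypothesis G_bounded : forall x, Rabs (G x) <= M.
Hypothesis G_lipschitz : forall x y, Rabs (G x - G y) <= L * Rabs (x - y).
Hypothesis lam_pos : 0 <= lam.
Hypothesis lam_L : lam * L <= 1 / 2.
Hypothesis lam_M : lam * M <= 1.

Let u := picard G lam qA qB.

Lemma lipschitz_nonneg : 0 <= L.
Proof.
  pose proof (G_lipschitz 1 0) as H. pose proof (Rabs_pos (G 1 - G 0)).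
  rewrite Rminus_0_r, Rabs_R1 in H. lra.
Qed.

Lemma comp_lipschitz_continuous (v : R -> R) :
  (forall x, continuous v x) -> forall x, continuous (fun y => G (v y)) x.
Proof.
  intros Hv x. apply (continuous_comp v G); [apply Hv|].
  exact (lipschitz_continuous G L G_lipschitz (v x)).
Qed.

Lemma segment_continuous (x : R) : continuous (segment qA qB) x.
Proof.
  apply (ex_derive_continuous (segment qA qB)). unfold segment. auto_derive. exact I.
Qed.

Lemma segment_add_green_continuous (h : R -> R) :
  (forall x, continuous h x) ->
  forall x, continuous (fun t => segment qA qB t + lam * green h t) x.
Proof.
  intros Hh x. apply (continuous_plus (segment qA qB)); [apply segment_continuous|].
  apply (continuous_scal_r lam (green h)), (ex_derive_continuous (green h)).
  exists (green' h x). apply green_spec, Hh.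
Qed.

Lemma picard_continuous (n : nat) (x : R) : continuous (u n) x.
Proof.
  revert x. induction n as [|n IH]; [exact segment_continuous|].
  apply segment_add_green_continuous, comp_lipschitz_continuous, IH.
Qed.

Lemma picard_step (n : nat) (t : R) :
  unit_interval t -> Rabs (u (S n) t - u n t) <= (1 / 2) ^ n.
Proof.
  revert t. induction n as [|n IH]; intros t Ht.
  - change (Rabs (segment qA qB t + lam * green (fun x => G (u 0%nat x)) t
              - segment qA qB t) <= 1).
    replace (_ - _) with (lam * green (fun x => G (u 0%nat x)) t) by ring.
    rewrite Rabs_mult, Rabs_right by lra.
    eapply Rle_trans; [|exact lam_M]. apply Rmult_le_compat_l; [exact lam_pos|].
    apply (fun H1 H2 => proj2 (green_bound _ M H1 H2 t Ht)); [|auto].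
    apply comp_lipschitz_continuous, picard_continuous.
  - change (Rabs (segment qA qB t + lam * green (fun x => G (u (S n) x)) t
              - (segment qA qB t + lam * green (fun x => G (u n x)) t)) <= (1 / 2) ^ S n).
    replace (_ - _) with (lam * (green (fun x => G (u (S n) x)) t
      - green (fun x => G (u n x)) t)) by ring.
    rewrite Rabs_mult, Rabs_right by lra.
    apply Rle_trans with (lam * (L * (1 / 2) ^ n)).
    + apply Rmult_le_compat_l; [exact lam_pos|].
      apply green_diff_bound; try (apply comp_lipschitz_continuous, picard_continuous); [|exact Ht].
      intros z Hz. eapply Rle_trans; [apply G_lipschitz|].
      apply Rmult_le_compat_l; [exact lipschitz_nonneg|auto].
    + rewrite <- Rmult_assoc. apply Rmult_le_compat_r; [apply pow_le; lra|exact lam_L].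
Qed.

(** The constant does not depend on [n], so it survives in the limit and makes the limit continuous,
    as [green] requires. *)
Lemma picard_lipschitz (n : nat) (x y : R) :
  unit_interval x -> unit_interval y ->
  Rabs (u n x - u n y) <= (Rabs (qB - qA) + 1) * Rabs (x - y).
Proof.
  intros Hx Hy.
  assert (D : exists v, deriv_on (u n) v /\
            forall t, unit_interval t -> Rabs (v t) <= Rabs (qB - qA) + 1).
  { destruct n as [|n].
    - exists (fun _ => qB - qA). split; [apply deriv_on_segment|]. intros; lra.
    - assert (Hc : forall x, continuous (fun y => G (u n y)) x)
        by (apply comp_lipschitz_continuous, picard_continuous).
      exists (fun t => (qB - qA) + lam * green' (fun y => G (u n y)) t). split.
      + apply deriv_on_plus; [apply deriv_on_segment|].
        apply deriv_on_scal, green_deriv_on, Hc.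
      + intros t Ht. eapply Rle_trans; [apply Rabs_triang|].
        apply Rplus_le_compat_l. rewrite Rabs_mult, Rabs_right by lra.
        eapply Rle_trans; [|exact lam_M]. apply Rmult_le_compat_l; [exact lam_pos|].
        apply (proj1 (green_bound _ M Hc (fun _ _ => G_bounded _) t Ht)). }
  destruct D as [v [D Hv]].
  destruct (deriv_on_MVT _ _ y x D Hy Hx) as [c [Hc ->]].
  rewrite Rabs_mult. apply Rmult_le_compat_r; [apply Rabs_pos|auto].
Qed.

Lemma bvp_solution :
  exists q r : R -> R, deriv_on q r /\ deriv_on r (fun t => lam * G (q t)) /\
    q 0 = qA /\ q 1 = qB /\
    forall t, unit_interval t -> Rabs (q t - segment qA qB t) <= 1.
Proof.
  assert (Hlim : forall t, exists l,
    forall n, Rabs (l - u n (clamp 0 1 t)) <= 2 * (1 / 2) ^ n).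
  { intros t. apply (geometric_limit (fun n => u n (clamp 0 1 t))).
    intros n. apply picard_step, clamp_in. lra. }
  (* The limit is taken at the clamped argument, which makes [ql] a function on the whole line with
     the Lipschitz bound everywhere. *)
  set (ql := fun t => proj1_sig (constructive_indefinite_description _ (Hlim t))).
  assert (Hql : forall t n, Rabs (ql t - u n (clamp 0 1 t)) <= 2 * (1 / 2) ^ n)
    by (intros t; exact (proj2_sig (constructive_indefinite_description _ (Hlim t)))).
  assert (Cql : forall x, continuous ql x).
  { apply (lipschitz_continuous ql (Rabs (qB - qA) + 1)). intros x y.
    apply (le_add_geometric _ _ 4). intros n.
    pose proof (Hql x n) as Hx. pose proof (Hql y n) as Hy.
    assert (Hxy : Rabs (u n (clamp 0 1 x) - u n (clamp 0 1 y))
                  <= (Rabs (qB - qA) + 1) * Rabs (x - y)).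
    { eapply Rle_trans; [apply picard_lipschitz; apply clamp_in; lra|].
      apply Rmult_le_compat_l; [pose proof (Rabs_pos (qB - qA)); lra|].
      apply clamp_lipschitz. }
    apply Rabs_le_between in Hx, Hy, Hxy. apply Rabs_le. lra. }
  set (h := fun t : R => G (ql t)).
  assert (Ch : forall x, continuous h x)
    by (apply comp_lipschitz_continuous, Cql).
  (* [ql] is only known to be Lipschitz. One more application of the iteration map gives a twice
     differentiable function, which is then shown to agree with [ql] on the unit interval. *)
  set (q := fun t => segment qA qB t + lam * green h t).
  assert (Hq : forall t, unit_interval t -> q t = ql t).
  { intros t Ht.
    assert (E : Rabs (q t - ql t) <= 0).
    { apply (le_add_geometric _ _ 2). intros n.
      assert (H1 : Rabs (q t - u (S n) t) <= (1 / 2) ^ n).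
      { change (Rabs (segment qA qB t + lam * green h t -
          (segment qA qB t + lam * green (fun x => G (u n x)) t)) <= (1 / 2) ^ n).
        replace (_ - _) with (lam * (green h t
          - green (fun x => G (u n x)) t)) by ring.
        rewrite Rabs_mult, Rabs_right by lra.
        apply Rle_trans with (lam * (L * (2 * (1 / 2) ^ n))).
        - apply Rmult_le_compat_l; [exact lam_pos|].
          apply green_diff_bound;
            [exact Ch|apply comp_lipschitz_continuous, picard_continuous| |exact Ht].
          intros z Hz. eapply Rle_trans; [apply G_lipschitz|].
          apply Rmult_le_compat_l; [exact lipschitz_nonneg|].
          pose proof (Hql z n) as H. rewrite clamp_id in H by exact Hz. exact H.
        - replace (lam * (L * (2 * (1 / 2) ^ n))) with (lam * L * (2 * (1 / 2) ^ n)) by ring.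
          replace ((1 / 2) ^ n) with (1 / 2 * (2 * (1 / 2) ^ n)) at 2 by field.
          apply Rmult_le_compat_r; [|exact lam_L].
          assert (0 <= (1 / 2) ^ n) by (apply pow_le; lra). lra. }
      pose proof (Hql t (S n)) as H2. rewrite clamp_id in H2 by exact Ht.
      apply Rabs_le_between in H1, H2. apply Rabs_le. simpl pow in H2. lra. }
    pose proof (Rabs_pos (q t - ql t)).
    assert (E0 : Rabs (q t - ql t) = 0) by lra.
    apply Rabs_eq_0 in E0. lra. }
  destruct (green_deriv_on _ Ch) as [D1 D2].
  destruct (green_spec _ Ch) as [_ [_ [E0 E1]]].
  exists q, (fun t => (qB - qA) + lam * green' h t).
  split; [|split; [|split; [|split]]].
  - apply deriv_on_plus; [apply deriv_on_segment|apply deriv_on_scal, D1].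
  - refine (deriv_on_ext _ _ _ _ (fun _ _ => eq_refl) _
      (deriv_on_plus _ _ _ _ (deriv_on_const (qB - qA)) (deriv_on_scal lam _ _ D2))).
    intros t Ht. simpl. rewrite Hq by exact Ht. unfold h. ring.
  - unfold q, segment. rewrite E0. ring.
  - unfold q, segment. rewrite E1. ring.
  - intros t Ht. unfold q.
    replace (_ - _) with (lam * green h t) by ring.
    rewrite Rabs_mult, Rabs_right by lra.
    eapply Rle_trans; [|exact lam_M]. apply Rmult_le_compat_l; [exact lam_pos|].
    apply (proj2 (green_bound _ M Ch (fun _ _ => G_bounded _) t Ht)).
Qed.

End BoundaryValueProblem.

Lemma smooth_clamp_lipschitz (F : R -> R) (r : R) :
  smooth F -> 0 <= r -> exists L M, 0 <= L /\ 0 <= M /\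
    (forall x, Rabs (F (clamp (- r) r x)) <= M) /\
    (forall x y, Rabs (F (clamp (- r) r x) - F (clamp (- r) r y)) <= L * Rabs (x - y)).
Proof.
  intros HF Hr.
  destruct (smooth_bounded F r HF) as [M [HM HFM]].
  destruct (smooth_bounded _ r (smooth_Derive F HF)) as [L [HL HFL]].
  assert (Hc : forall x, - r <= clamp (- r) r x <= r) by (intros; apply clamp_in; lra).
  exists L, M. split; [exact HL|]. split; [exact HM|]. split.
  - intros x. apply HFM, Rabs_le, Hc.
  - intros x y.
    destruct (MVT_gen F (clamp (- r) r y) (clamp (- r) r x) (Derive F)) as [c [Hcc ->]].
    + intros z _. apply smooth_is_derive, HF.
    + intros z _. apply continuity_pt_filterlim, (ex_derive_continuous F),
        smooth_ex_derive, HF.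
    + rewrite Rabs_mult. apply Rmult_le_compat; try apply Rabs_pos.
      * apply HFL, Rabs_le. pose proof (Hc x). pose proof (Hc y).
        revert Hcc. unfold Rmin, Rmax. repeat destruct Rle_dec; lra.
      * apply clamp_lipschitz.
Qed.

Lemma segment_bound (qA qB t : R) :
  unit_interval t -> Rabs (segment qA qB t) <= Rabs qA + Rabs qB.
Proof.
  unfold unit_interval, segment. intros Ht.
  eapply Rle_trans; [apply Rabs_triang|]. rewrite !Rabs_mult.
  rewrite (Rabs_right (1 - t)), (Rabs_right t) by lra.
  pose proof (Rabs_pos qA). pose proof (Rabs_pos qB). nra.
Qed.

Lemma bvp_solution_small (F : R -> R) (qA qB : R) :
  smooth F -> at_right 0 (fun lam => exists q r : R -> R,
    deriv_on q r /\ deriv_on r (fun t => lam * F (q t)) /\ q 0 = qA /\ q 1 = qB /\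
    forall t, unit_interval t -> Rabs (q t - segment qA qB t) <= 1).
Proof.
  intros HF.
  (* The segment lies in the ball of radius [Rabs qA + Rabs qB] and the solution stays within 1 of
     it, so the cutoff at [r0] is inactive along the solution. *)
  set (r0 := Rabs qA + Rabs qB + 1).
  assert (Hr0 : 0 <= r0)
    by (unfold r0; pose proof (Rabs_pos qA); pose proof (Rabs_pos qB); lra).
  destruct (smooth_clamp_lipschitz F r0 HF Hr0) as [L [M [HL [HM [HB HLip]]]]].
  (* Below this threshold [lam * L <= 1 / 2] and [lam * M <= 1]; the added 1 keeps the denominator
     positive. *)
  apply at_right_0_iff. exists (/ (2 * (L + M + 1))).
  split; [apply Rinv_0_lt_compat; lra|]. intros lam [Hl0 Hl].
  assert (Hl' : lam * (2 * (L + M + 1)) <= 1).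
  { apply Rmult_lt_compat_r with (r := 2 * (L + M + 1)) in Hl; [|lra].
    rewrite Rinv_l in Hl by lra. lra. }
  destruct (bvp_solution (fun x => F (clamp (- r0) r0 x)) L M lam qA qB)
    as [q [r [D1 [D2 [E0 [E1 B]]]]]]; [exact HB|exact HLip|lra|nra|nra|].
  exists q, r. repeat split; auto.
  refine (deriv_on_ext _ _ _ _ (fun _ _ => eq_refl) _ D2).
  intros t Ht. simpl. rewrite clamp_id; [reflexivity|].
  pose proof (segment_bound qA qB t Ht) as Hs. specialize (B t Ht).
  apply Rabs_le_between in Hs, B. unfold r0. lra.
Qed.

(** * Expansion of the solutions *)

(** The sup bounds of [d] and [s] come from the boundary values, their higher derivatives from [w]:
    inverting the second derivative gains two derivatives at the same order in [e]. *)
Lemma bigO_dirichlet (n k : nat) (d s w : R -> R -> R) :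
  fam_deriv d s -> fam_deriv s w ->
  at_right 0 (fun e => d e 0 = 0 /\ d e 1 = 0) -> bigO n k w ->
  bigO n (S (S k)) d /\ bigO n (S k) s.
Proof.
  intros Dd Ds Hbc Hw.
  destruct (bigO_sup _ _ _ Hw) as [C [HC Hs]].
  assert (H : at_right 0 (fun e => forall t, unit_interval t ->
            Rabs (s e t) <= C * e ^ n /\ Rabs (d e t) <= C * e ^ n)).
  { generalize (filter_and (F := at_right 0) _ _ Dd
      (filter_and (F := at_right 0) _ _ Ds (filter_and (F := at_right 0) _ _ Hbc Hs))).
    apply (filter_imp (F := at_right 0)). intros e [H1 [H2 [[H3 H4] H5]]].
    exact (dirichlet_bound _ _ _ _ H1 H2 H3 H4 H5). }
  assert (Bs : bigO n (S k) s).
  { split; [|exists w; auto]. exists C. split; [exact HC|].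
    revert H. apply (filter_imp (F := at_right 0)). intros e H t Ht. apply H, Ht. }
  split; [|exact Bs]. split; [|exists s; auto]. exists C. split; [exact HC|].
  revert H. apply (filter_imp (F := at_right 0)). intros e H t Ht. apply H, Ht.
Qed.

Lemma smooth_unit_dirichlet (a : R -> R) :
  smooth_unit a -> exists b c, deriv_on b c /\ deriv_on c a /\ b 0 = 0 /\ b 1 = 0 /\
    smooth_unit b /\ smooth_unit c.
Proof.
  intros Ha. destruct (smooth_unit_deriv a Ha) as [a' Da].
  set (h := fun t : R => a (clamp 0 1 t)).
  assert (Ch : forall x, continuous h x)
    by exact (deriv_on_clamp_continuous a a' Da).
  destruct (green_spec h Ch) as [_ [_ [E0 E1]]].
  destruct (green_deriv_on h Ch) as [D1 D2].
  assert (D2' : deriv_on (green' h) a).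
  { refine (deriv_on_ext _ _ _ _ (fun _ _ => eq_refl) _ D2).
    intros t Ht. unfold h. rewrite clamp_id; [reflexivity|exact Ht]. }
  assert (Hc : smooth_unit (green' h)) by exact (smooth_unit_deriv_intro _ _ D2' Ha).
  exists (green h), (green' h). repeat split; auto.
  exact (smooth_unit_deriv_intro _ _ D1 Hc).
Qed.

Lemma fam_deriv_div_eps (f g : R -> R -> R) (a b : R -> R) :
  fam_deriv f g -> deriv_on a b ->
  fam_deriv (fun e t => (f e t - a t) / e) (fun e t => (g e t - b t) / e).
Proof.
  intros Df Da. revert Df. apply (filter_imp (F := at_right 0)). intros e Df.
  refine (deriv_on_ext _ _ _ _ _ _ (deriv_on_scal (/ e) _ _
    (deriv_on_minus _ _ _ _ Df Da))); intros t _; unfold Rdiv; ring.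
Qed.

Lemma fam_deriv_ext_r (f g h : R -> R -> R) :
  fam_eq g h -> fam_deriv f g -> fam_deriv f h.
Proof.
  intros E D. generalize (filter_and (F := at_right 0) _ _ E D).
  apply (filter_imp (F := at_right 0)). intros e [E' D'].
  exact (deriv_on_ext _ _ _ _ (fun _ _ => eq_refl) E' D').
Qed.

(** By linearity: subtract the solution [b] for the leading coefficient of [w] and divide by [e];
    the quotients solve the same problem with the next remainder on the right. *)
Lemma expands_dirichlet (N : nat) (d s w : R -> R -> R) :
  fam_deriv d s -> fam_deriv s w ->
  at_right 0 (fun e => d e 0 = 0 /\ d e 1 = 0) -> expands N w ->
  expands N d /\ expands N s.
Proof.
  revert d s w. induction N as [|N IH]; intros d s w Dd Ds Hbc Hw.
  - split; intros k; destruct (bigO_dirichlet 0 k d s w Dd Ds Hbc (Hw k)) as [H1 H2].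
    + apply bigO_pred, bigO_pred, H1.
    + apply bigO_pred, H2.
  - destruct Hw as [a [h [Ha [Hh Ew]]]].
    destruct (smooth_unit_dirichlet a Ha) as [b [c [Db [Dc [b0 [b1 [Hb Hc]]]]]]].
    destruct (IH (fun e t => (d e t - b t) / e) (fun e t => (s e t - c t) / e)
                (fun e t => (w e t - a t) / e)) as [Id Is].
    + apply fam_deriv_div_eps; assumption.
    + apply fam_deriv_div_eps; assumption.
    + revert Hbc. apply (filter_imp (F := at_right 0)). intros e [d0 d1].
      rewrite d0, d1, b0, b1. unfold Rdiv. split; ring.
    + apply (expands_ext _ h); [|exact Hh].
      generalize (filter_and (F := at_right 0) _ _ (at_right_0_lt 1 Rlt_0_1) Ew).
      apply (filter_imp (F := at_right 0)). intros e [He E] t Ht.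
      rewrite (E t Ht). field. lra.
    + split; [exists b, (fun e t => (d e t - b t) / e)
             |exists c, (fun e t => (s e t - c t) / e)]; (split; [assumption|]);
        (split; [assumption|]); apply fam_eq_all; intros e t He _; field; lra.
Qed.

Lemma smooth_unit_segment (qA qB : R) : smooth_unit (segment qA qB).
Proof.
  exact (smooth_unit_deriv_intro _ _ (deriv_on_segment qA qB) (smooth_unit_const _)).
Qed.

Lemma bvp_expands (F : R -> R) (qA qB : R) (q r : R -> R -> R) :
  smooth F ->
  at_right 0 (fun e => deriv_on (q e) (r e) /\
    deriv_on (r e) (fun t => e ^ 2 * F (q e t)) /\ q e 0 = qA /\ q e 1 = qB /\
    forall t, unit_interval t -> Rabs (q e t - segment qA qB t) <= 1) ->
  exists g s, (forall N, expands N g /\ expands N s) /\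
    fam_eq q (fun e t => segment qA qB t + e * g e t) /\
    fam_eq r (fun e t => (qB - qA) + e * s e t).
Proof.
  intros HF Hsol.
  assert (Dd : fam_deriv (fun e t => q e t - segment qA qB t) (fun e t => r e t - (qB - qA))).
  { revert Hsol. apply (filter_imp (F := at_right 0)). intros e [D _].
    apply deriv_on_minus; [exact D|apply deriv_on_segment]. }
  assert (Ds : fam_deriv (fun e t => r e t - (qB - qA)) (fun e t => e ^ 2 * F (q e t) - 0)).
  { revert Hsol. apply (filter_imp (F := at_right 0)). intros e [_ [D _]].
    apply deriv_on_minus; [exact D|apply deriv_on_const]. }
  assert (Hbc : at_right 0 (fun e => q e 0 - segment qA qB 0 = 0 /\
                                     q e 1 - segment qA qB 1 = 0)).
  { revert Hsol. apply (filter_imp (F := at_right 0)). intros e [_ [_ [E0 [E1 _]]]].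
    rewrite E0, E1. unfold segment. split; ring. }
  (* Bounds on [q] in tau must precede any expansion: a bound on [k] derivatives of [q] passes to
     [F (q e t)], and the equation returns it for more derivatives of [q]. *)
  assert (Hq : forall k, bigO 0 k q).
  { induction k as [|k IH].
    - split; [|exact I]. exists (Rabs qA + Rabs qB + 1). split.
      { pose proof (Rabs_pos qA); pose proof (Rabs_pos qB); lra. }
      revert Hsol. apply (filter_imp (F := at_right 0)). intros e [_ [_ [_ [_ B]]]] t Ht.
      specialize (B t Ht). pose proof (segment_bound qA qB t Ht) as Hs.
      simpl. apply Rabs_le_between in B, Hs. apply Rabs_le. lra.
    - assert (Hw : bigO 0 k (fun e t => e ^ 2 * F (q e t) - 0)).
      { apply (bigO_ext _ _ (fun e t => e * (e * F (q e t)))).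
        - apply fam_eq_all; intros; ring.
        - do 2 apply bigO_order_pred, bigO_mult_eps. apply bigO_comp; assumption. }
      apply (bigO_ext _ _ (fun e t => segment qA qB t + (q e t - segment qA qB t)));
        [apply fam_eq_all; intros; ring|].
      apply bigO_plus; [apply smooth_unit_segment|].
      apply bigO_pred. exact (proj1 (bigO_dirichlet _ _ _ _ _ Dd Ds Hbc Hw)). }
  (* The subtracted 0 matches the shape of [fam_deriv_div_eps] with zero coefficient. *)
  set (g := fun e t => (q e t - segment qA qB t - 0) / e).
  set (s := fun e t => (r e t - (qB - qA) - 0) / e).
  assert (Eq : fam_eq q (fun e t => segment qA qB t + e * g e t))
    by (apply fam_eq_all; intros e t He _; unfold g; field; lra).
  assert (Er : fam_eq r (fun e t => (qB - qA) + e * s e t))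
    by (apply fam_eq_all; intros e t He _; unfold s; field; lra).
  (* One factor of [e ^ 2] is absorbed in [g], leaving [e * F q] on the right. With [expands_comp]
     this closes the loop: [N] coefficients of [F q] give [N] of [g], hence [N + 1] of [F q]. *)
  assert (Hgs : forall N, expands N (fun e t => F (q e t)) -> expands N g /\ expands N s).
  { intros N HN.
    apply (expands_dirichlet N g s (fun e t => e * F (q e t))).
    - exact (fam_deriv_div_eps _ _ _ _ Dd (deriv_on_const 0)).
    - refine (fam_deriv_ext_r _ _ _ _ (fam_deriv_div_eps _ _ _ _ Ds (deriv_on_const 0))).
      apply fam_eq_all. intros e t He _. field. lra.
    - revert Hbc. apply (filter_imp (F := at_right 0)). intros e [E0 E1].
      unfold g. rewrite E0, E1. unfold Rdiv. split; ring.
    - apply expands_pred, expands_mult_eps, HN. }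
  exists g, s. split; [|split; assumption].
  intros N. apply Hgs. induction N as [|N IH].
  - intros k. apply bigO_comp; auto.
  - apply (expands_ext _ (fun e t => F (segment qA qB t + e * g e t))).
    + revert Eq. apply (filter_imp (F := at_right 0)). intros e E t Ht.
      rewrite (E t Ht). reflexivity.
    + apply expands_comp; [exact HF|apply smooth_unit_segment|apply Hgs, IH].
Qed.

(** * Canonical coefficients of an expansion *)

Lemma bigO_filterlim (f : R -> R -> R) (a : R -> R) (t : R) :
  bigO 1 0 (fun e t => f e t - a t) -> unit_interval t ->
  filterlim (fun e => f e t) (at_right 0) (locally (a t)).
Proof.
  intros [[C [HC H]] _] Ht. apply filterlim_locally. intros eps.
  assert (Hd : 0 < eps / (C + 1)) by (apply Rdiv_lt_0_compat; [apply cond_pos|lra]).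
  generalize (filter_and (F := at_right 0) _ _ H (at_right_0_lt _ Hd)).
  apply (filter_imp (F := at_right 0)). intros e [H1 He].
  change (Rabs (f e t - a t) < eps).
  eapply Rle_lt_trans; [apply H1, Ht|]. rewrite pow_1.
  apply Rle_lt_trans with ((C + 1) * e); [nra|].
  apply Rlt_le_trans with ((C + 1) * (eps / (C + 1))); [nra|].
  right. field. lra.
Qed.

(* The limit of [f e t] as [e -> 0+], when it exists. *)
Definition lead (f : R -> R -> R) (t : R) : R :=
  real (Lim_seq (fun n => f (/ INR (S n)) t)).

(** If [f = a + e g] with [g] bounded, then [lead] recovers [a] and [next] recovers [g]. Neither
    mentions the number of terms, so iterating them gives one coefficient sequence for all
    truncations. *)
Definition next (f : R -> R -> R) (e t : R) : R := (f e t - lead f t) / e.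

Definition coef (f : R -> R -> R) (n : nat) : R -> R := lead (Nat.iter n next f).

Lemma lead_filterlim (f : R -> R -> R) (t l : R) :
  filterlim (fun e => f e t) (at_right 0) (locally l) -> lead f t = l.
Proof.
  intros H. unfold lead.
  rewrite (is_lim_seq_unique _ l); [reflexivity|].
  apply (filterlim_comp _ _ _ (fun n => / INR (S n)) (fun e => f e t)
           eventually (at_right 0)); [|exact H].
  intros P HP. apply at_right_0_iff in HP. destruct HP as [d [Hd HP]].
  destruct (archimed_cor1 d Hd) as [n [Hn Hn0]].
  exists n. intros k Hk. apply HP. split.
  - apply Rinv_0_lt_compat, lt_0_INR. lia.
  - eapply Rle_lt_trans; [|exact Hn]. apply Rinv_le_contravar.
    + apply lt_0_INR, Hn0.
    + apply le_INR. lia.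
Qed.

Lemma lead_expands (N : nat) (f g : R -> R -> R) (a : R -> R) :
  smooth_unit a -> expands N g -> fam_eq f (fun e t => a t + e * g e t) ->
  forall t, unit_interval t -> lead f t = a t.
Proof.
  intros Ha Hg E t Ht. apply lead_filterlim, bigO_filterlim; [|exact Ht].
  apply (bigO_ext _ _ (fun e t => e * g e t)).
  - revert E. apply (filter_imp (F := at_right 0)). intros e E z Hz.
    rewrite (E z Hz). ring.
  - apply bigO_mult_eps, (expands_bigO N), Hg.
Qed.

Lemma expands_lead_next (N : nat) (f : R -> R -> R) :
  expands (S N) f -> smooth_unit (lead f) /\ expands N (next f).
Proof.
  intros [a [g [Ha [Hg E]]]].
  assert (L := lead_expands N f g a Ha Hg E).
  split.
  - apply (smooth_unit_ext a); [|exact Ha]. intros t Ht. symmetry. apply L, Ht.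
  - apply (expands_ext _ g); [|exact Hg].
    generalize (filter_and (F := at_right 0) _ _ (at_right_0_lt 1 Rlt_0_1) E).
    apply (filter_imp (F := at_right 0)). intros e [He E'] t Ht.
    unfold next. rewrite (E' t Ht), (L t Ht). field. lra.
Qed.

Lemma expands_iter_next (f : R -> R -> R) (n : nat) :
  (forall N, expands N f) -> forall N, expands N (Nat.iter n next f).
Proof.
  intros H. induction n as [|n IH]; [exact H|].
  intros N. apply expands_lead_next, IH.
Qed.

Lemma smooth_unit_coef (f : R -> R -> R) (n : nat) :
  (forall N, expands N f) -> smooth_unit (coef f n).
Proof. intros H. apply (expands_lead_next 0), expands_iter_next, H. Qed.

(** Purely algebraic, whatever values [lead] takes: [next] is defined so as to be undone. Analysis
    enters only in bounding the last iterate. *)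
Lemma coef_expansion (f : R -> R -> R) (n : nat) (e t : R) :
  e <> 0 ->
  f e t = sum_n_m (fun i => e ^ i * coef f i t) 0 n + e ^ S n * Nat.iter (S n) next f e t.
Proof.
  intros He. induction n as [|n IH].
  - rewrite sum_n_n. unfold coef. simpl. unfold next. field. exact He.
  - assert (E : Nat.iter (S n) next f e t =
                coef f (S n) t + e * Nat.iter (S (S n)) next f e t).
    { change (Nat.iter (S (S n)) next f) with (next (Nat.iter (S n) next f)).
      unfold next at 2. unfold coef. field. exact He. }
    rewrite sum_n_Sm by lia. rewrite IH, E. unfold plus; simpl pow.
    change (AbelianMonoid.plus _ _) with Rplus. ring.
Qed.

Lemma bigO_coef_remainder (f : R -> R -> R) (n j k : nat) :
  (forall N, expands N f) -> bigO n k (fun e t => e ^ n * Nat.iter j next f e t).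
Proof.
  intros H. rewrite <- (Nat.add_0_r n) at 1. apply (bigO_mult n 0).
  - apply (bigO_ext _ _ (fun e _ => 1 * e ^ n)); [|apply bigO_monomial].
    apply fam_eq_all; intros; ring.
  - apply (expands_bigO 0), expands_iter_next, H.
Qed.

Lemma q_uniform_remainder (qA qB : R) (q : R -> R -> R) (N : nat) :
  (forall n, expands n q) ->
  (forall t, unit_interval t -> coef q 0 t = segment qA qB t) ->
  uniform_remainder (fun e t => q e t - q_truncation qA qB (coef q) N e t) (S N).
Proof.
  intros Hq H0. apply bigO_uniform_remainder. intros k.
  refine (bigO_ext _ _ _ _ _ (bigO_coef_remainder q (S N) (S N) k Hq)).
  apply fam_eq_all. intros e t He Ht.
  rewrite (coef_expansion q N e t) by lra.
  rewrite sum_Sn_m by lia. unfold q_truncation.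
  rewrite <- (H0 t Ht). unfold plus; simpl pow at 2; simpl. ring.
Qed.

Lemma p_uniform_remainder (p : R -> R -> R) (N : nat) :
  (forall n, expands n (fun e t => e * p e t)) ->
  uniform_remainder (fun e t => p e t - p_truncation
    (fun z => coef (fun e t => e * p e t) (Z.to_nat (z + 1))) N e t) (S N).
Proof.
  set (f := fun e t => e * p e t). intros Hf. apply bigO_uniform_remainder. intros k.
  (* Powers -1 to N of [p] are powers 0 to [S N] of [e * p]. The remainder of the latter has the
     factor [e ^ S (S N)]; dividing by [e] leaves [e ^ S N] with the same iterate. *)
  refine (bigO_ext _ _ _ _ _ (bigO_coef_remainder f (S N) (S (S N)) k Hf)).
  apply fam_eq_all. intros e t He Ht.
  unfold p_truncation.
  rewrite (sum_n_m_ext _ (fun i => mult (/ e) (e ^ i * coef f i t))).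
  2:{ intros i. cbv zeta. replace (Z.of_nat i - 1 + 1)%Z with (Z.of_nat i) by lia.
      unfold Z.sub. rewrite Nat2Z.id, powerRZ_add, <- pow_powerRZ by lra.
      unfold mult; simpl. field. lra. }
  rewrite sum_n_m_mult_l.
  assert (E := coef_expansion f (S N) e t ltac:(lra)).
  unfold f at 1 in E. unfold mult; simpl mult.
  apply Rmult_eq_reg_l with e; [|lra].
  change (e * (e ^ S N * Nat.iter (S (S N)) next f e t) =
    e * (p e t - / e * sum_n_m (fun i => e ^ i * coef f i t) 0 (S N))).
  rewrite Rmult_minus_distr_l, E, <- Rmult_assoc, <- (Rmult_assoc e (/ e)), Rinv_r by lra.
  change (e * e ^ S N) with (e ^ S (S N)). ring.
Qed.

Lemma at_right_choice (T : Type) (P : R -> T -> Prop) (x0 : T) :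
  at_right 0 (fun e => exists x, P e x) ->
  exists f : R -> T, at_right 0 (fun e => P e (f e)).
Proof.
  intros H. exists (fun e => epsilon (inhabits x0) (P e)).
  revert H. apply (filter_imp (F := at_right 0)). intros e. apply epsilon_spec.
Qed.

(** * The Hamiltonian *)

Lemma smooth_plus (f g : R -> R) : smooth f -> smooth g -> smooth (fun x => f x + g x).
Proof.
  intros Hf Hg n x. apply ex_derive_n_plus; apply filter_forall; auto.
Qed.

Lemma smooth_scal (c : R) (f : R -> R) : smooth f -> smooth (fun x => c * f x).
Proof. intros Hf n x. apply ex_derive_n_scal_l, Hf. Qed.

(** [ex_derive_n] differentiates last on the outside; here the first derivative is split off, as the
    product rule requires. *)
Lemma ex_derive_n_succ (h h' : R -> R) (n : nat) :
  (forall x, is_derive h x (h' x)) -> (forall x, ex_derive_n h' n x) ->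
  forall x, ex_derive_n h (S n) x.
Proof.
  intros D H x. destruct n as [|n]; [exists (h' x); apply D|].
  apply (ex_derive_ext (Derive_n h' n)); [|exact (H x)].
  intros t. rewrite <- (Derive_n_Derive h n). apply Derive_n_ext.
  intros y. symmetry. apply is_derive_unique, D.
Qed.

Lemma smooth_mult (f g : R -> R) : smooth f -> smooth g -> smooth (fun x => f x * g x).
Proof.
  intros Hf Hg n.
  (* The sum rule asks for all orders up to [k], and the product rule changes the factors, so the
     induction covers every [k <= n] and all smooth factors. *)
  assert (H : forall k f g, (k <= n)%nat -> smooth f -> smooth g ->
            forall x, ex_derive_n (fun x => f x * g x) k x).
  { clear f g Hf Hg. induction n as [|n IH]; intros k f g Hk Hf Hg x.
    - replace k with O by lia. exact I.
    - destruct k as [|k]; [exact I|].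
      apply (ex_derive_n_succ _ (fun x => Derive f x * g x + f x * Derive g x)).
      + intros y. apply (is_derive_mult f g); try (apply smooth_is_derive; assumption).
        exact Rmult_comm.
      + intros y. apply ex_derive_n_plus; apply filter_forall; intros z j Hj;
          apply IH; auto using smooth_Derive; lia. }
  intros x. apply H; auto.
Qed.

Section Hamiltonian.
Variables (m u0 V : R -> R).
Hypotheses (m_smooth : smooth m) (u0_smooth : smooth u0) (V_smooth : smooth V).
Hypothesis m_neq0 : forall q, m q <> 0.

Lemma hamiltonian_Derive_p (q p : R) :
  Derive (fun y => hamiltonian m u0 V q y) p = p / m q + u0 q.
Proof.
  apply is_derive_unique. unfold hamiltonian. auto_derive; [exact I|].
  field. apply m_neq0.
Qed.

Lemma hamiltonian_Derive_q (q p : R) :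
  Derive (fun x => hamiltonian m u0 V x p) q =
  - Derive m q / (2 * m q ^ 2) * p ^ 2 + Derive u0 q * p + Derive V q.
Proof.
  apply is_derive_unique. unfold hamiltonian. auto_derive.
  - repeat split; auto using smooth_ex_derive.
  - change (Derive (fun x => m x) q) with (Derive m q).
    change (Derive (fun x => u0 x) q) with (Derive u0 q).
    change (Derive (fun x => V x) q) with (Derive V q).
    field. apply m_neq0.
Qed.

Definition force (m0 x : R) : R := u0 x * Derive u0 x + (- / m0) * Derive V x.

Lemma smooth_force (m0 : R) : smooth (force m0).
Proof.
  apply smooth_plus; [apply smooth_mult|apply smooth_scal]; auto using smooth_Derive.
Qed.

(* Eliminating the momentum, Hamilton's equations become [q'' = eps ^ 2 * force q]. *)
Lemma rescaled_solution_of_force (m0 qA qB e : R) (q r : R -> R) :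
  (forall x, m x = m0) -> e <> 0 ->
  deriv_on q r -> deriv_on r (fun t => e ^ 2 * force m0 (q t)) ->
  q 0 = qA -> q 1 = qB ->
  rescaled_solution (hamiltonian m u0 V) qA qB e q (fun t => m0 * (r t / e - u0 (q t))).
Proof.
  intros Hm He Dq Dr E0 E1.
  assert (Hm0 : m0 <> 0) by (rewrite <- (Hm 0); apply m_neq0).
  assert (Dm : forall x, Derive m x = 0).
  { intros x. rewrite (Derive_ext m (fun _ => m0)) by exact Hm. apply Derive_const. }
  split; [|split; [|split; assumption]].
  - refine (deriv_on_ext _ _ _ _ (fun _ _ => eq_refl) _ Dq).
    intros t _. rewrite hamiltonian_Derive_p, Hm. field. auto.
  - refine (deriv_on_ext _ _ _ _ _ _
      (deriv_on_scal m0 _ _ (deriv_on_minus _ _ _ _ (deriv_on_scal (/ e) _ _ Dr)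
        (deriv_on_comp _ _ _ _ (smooth_is_derive _ u0_smooth) Dq)))).
    + intros t _. simpl. unfold Rdiv. ring.
    + intros t _. rewrite hamiltonian_Derive_q, Dm, Hm. unfold force. field. auto.
Qed.

Lemma secular_expansion_valid_of_constant_mass (m0 qA qB : R) :
  (forall x, m x = m0) -> secular_expansion_valid (hamiltonian m u0 V) qA qB.
Proof.
  intros Hm. set (F := force m0).
  assert (HF : smooth F) by apply smooth_force.
  assert (Hex : at_right 0 (fun e => exists qr : (R -> R) * (R -> R),
    deriv_on (fst qr) (snd qr) /\
    deriv_on (snd qr) (fun t => e ^ 2 * F (fst qr t)) /\
    fst qr 0 = qA /\ fst qr 1 = qB /\
    forall t, unit_interval t -> Rabs (fst qr t - segment qA qB t) <= 1)).
  { pose proof (bvp_solution_small F qA qB HF) as H.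
    apply at_right_0_iff in H. destruct H as [d [Hd H]].
    (* The parameter of the boundary value problem is [e ^ 2], which stays below [e], hence below
       [d], once [e < 1]. *)
    apply at_right_0_iff. exists (Rmin 1 d). split; [apply Rmin_pos; lra|].
    intros e [He1 He2]. pose proof (Rmin_l 1 d). pose proof (Rmin_r 1 d).
    destruct (H (e ^ 2)) as [q [r Hqr]]; [simpl; nra|].
    exists (q, r). exact Hqr. }
  destruct (at_right_choice _ _ (fun _ => 0, fun _ => 0) Hex) as [qr Hqr].
  set (q := fun e => fst (qr e)). set (r := fun e => snd (qr e)).
  destruct (bvp_expands F qA qB q r HF Hqr) as [g [s [Hgs [Eq Er]]]].
  assert (Hq : forall N, expands N q).
  { intros N. apply (expands_ext _ _ _ (fam_eq_sym _ _ Eq)), expands_plus.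
    - apply (expands_smooth N (segment qA qB)), smooth_unit_segment.
    - apply expands_pred, expands_mult_eps, Hgs. }
  assert (Hr : forall N, expands N r).
  { intros N. apply (expands_ext _ _ _ (fam_eq_sym _ _ Er)), expands_plus.
    - apply (expands_smooth N (fun _ => qB - qA)), smooth_unit_const.
    - apply expands_pred, expands_mult_eps, Hgs. }
  assert (Hu : forall N, expands N (fun e t => u0 (q e t))).
  { intros N. apply (expands_ext _ (fun e t => u0 (segment qA qB t + e * g e t))).
    - revert Eq. apply (filter_imp (F := at_right 0)). intros e E t Ht.
      rewrite (E t Ht). reflexivity.
    - apply expands_pred, expands_comp; [exact u0_smooth|apply smooth_unit_segment|apply Hgs]. }
  set (p := fun e t => m0 * (r e t / e - u0 (q e t))).
  assert (Hp : forall N, expands N (fun e t => e * p e t)).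
  { intros N. apply (expands_ext _ (fun e t => m0 * (r e t + (-1) * (e * u0 (q e t))))).
    - apply fam_eq_all. intros e t He _. unfold p. field. lra.
    - apply expands_scal, expands_plus; [apply Hr|].
      apply expands_scal, expands_pred, expands_mult_eps, Hu. }
  assert (Hc0 : forall t, unit_interval t -> coef q 0 t = segment qA qB t).
  { apply (lead_expands 0 q g (segment qA qB));
      [apply smooth_unit_segment|apply Hgs|exact Eq]. }
  (* The coefficient of [e * p] at order n is that of [p] at order n - 1. *)
  exists q, p, (coef q), (fun z => coef (fun e t => e * p e t) (Z.to_nat (z + 1))).
  split; [|split; [|split; [|split]]].
  - apply at_right_0_iff.
    generalize (filter_and (F := at_right 0) _ _ (at_right_0_lt 1 Rlt_0_1) Hqr).
    apply (filter_imp (F := at_right 0)). intros e [He [D1 [D2 [E0 [E1 _]]]]].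
    apply rescaled_solution_of_force; auto. lra.
  - intros n _. apply smooth_unit_smooth_on, smooth_unit_coef, Hq.
  - intros n _. apply smooth_unit_smooth_on, smooth_unit_coef, Hp.
  - intros N. apply q_uniform_remainder; assumption.
  - intros N. apply p_uniform_remainder, Hp.
Qed.

(** * Leading orders of Hamilton's equations *)

Lemma uniform_remainder_sup_O (f : R -> R -> R) (n : nat) :
  uniform_remainder f n -> sup_O n f.
Proof.
  intros H. destruct (H O) as [C [d [Hd HC]]].
  exists (Rabs C). split; [apply Rabs_pos|].
  apply at_right_0_iff. exists d. split; [exact Hd|].
  intros e He t Ht. destruct (HC e He) as [g [Hg B]].
  rewrite <- (Hg t Ht). eapply Rle_trans; [apply B, Ht|].
  apply Rmult_le_compat_r; [apply pow_le; lra|apply Rle_abs].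
Qed.

(** This is where differentiating the expansion term by term enters: by uniqueness, the derivative
    bounded in [uniform_remainder] is the one that the equations supply. *)
Lemma uniform_remainder_deriv_sup_O (f f' : R -> R -> R) (n : nat) :
  uniform_remainder f n -> fam_deriv f f' -> sup_O n f'.
Proof.
  intros H D. destruct (H 1%nat) as [C [d [Hd HC]]].
  exists (Rabs C). split; [apply Rabs_pos|].
  generalize (filter_and (F := at_right 0) _ _ D (at_right_0_lt d Hd)).
  apply (filter_imp (F := at_right 0)). intros e [De He] t Ht.
  destruct (HC e He) as [g [[h [Eh Dh]] B]].
  assert (Dg : deriv_on (f e) g)
    by (refine (deriv_on_ext _ _ _ _ Eh (fun _ _ => eq_refl) _); exact Dh).
  rewrite (deriv_on_unique _ _ _ De Dg t Ht).
  eapply Rle_trans; [apply B, Ht|].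
  apply Rmult_le_compat_r; [apply pow_le; lra|apply Rle_abs].
Qed.

Definition limit_0 (f : R -> R) (l : R) : Prop := filterlim f (at_right 0) (locally l).

Lemma limit_0_ext (f g : R -> R) (l : R) :
  (forall e, 0 < e -> f e = g e) -> limit_0 f l -> limit_0 g l.
Proof.
  intros E. apply filterlim_ext_loc.
  generalize (at_right_0_lt 1 Rlt_0_1). apply filter_imp. intros e He. apply E. lra.
Qed.

Lemma limit_0_const (c : R) : limit_0 (fun _ => c) c.
Proof. apply filterlim_const. Qed.

Lemma limit_0_id : limit_0 (fun e => e) 0.
Proof. intros P. apply filter_le_within. Qed.

Lemma limit_0_plus (f g : R -> R) (a b : R) :
  limit_0 f a -> limit_0 g b -> limit_0 (fun e => f e + g e) (a + b).
Proof.
  intros Hf Hg. exact (filterlim_comp_2 _ _ Rplus Hf Hg (filterlim_plus a b)).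
Qed.

Lemma limit_0_mult (f g : R -> R) (a b : R) :
  limit_0 f a -> limit_0 g b -> limit_0 (fun e => f e * g e) (a * b).
Proof.
  intros Hf Hg. exact (filterlim_comp_2 _ _ Rmult Hf Hg (filterlim_mult a b)).
Qed.

Lemma limit_0_comp (F f : R -> R) (a : R) :
  continuous F a -> limit_0 f a -> limit_0 (fun e => F (f e)) (F a).
Proof. intros HF Hf. exact (filterlim_comp _ _ _ _ _ _ _ _ Hf HF). Qed.

Lemma limit_0_unique (f g : R -> R) (a b : R) :
  (forall e, 0 < e -> f e = g e) -> limit_0 f a -> limit_0 g b -> a = b.
Proof.
  intros E Hf Hg.
  exact (filterlim_locally_unique g a b (limit_0_ext f g a E Hf) Hg).
Qed.

Lemma limit_0_sup_O (f : R -> R -> R) (t : R) :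
  sup_O 1 f -> unit_interval t -> limit_0 (fun e => f e t) 0.
Proof.
  intros H Ht. apply (bigO_filterlim f (fun _ => 0) t); [|exact Ht].
  split; [|exact I]. refine (sup_O_ext _ _ _ _ H). apply fam_eq_all; intros; ring.
Qed.

Lemma smooth_continuous (F : R -> R) (x : R) : smooth F -> continuous F x.
Proof. intros H. apply (ex_derive_continuous F), smooth_ex_derive, H. Qed.

Lemma q_truncation_0 (qA qB : R) (chi : nat -> R -> R) (e t : R) :
  q_truncation qA qB chi 0 e t = segment qA qB t.
Proof.
  unfold q_truncation. rewrite sum_n_m_zero by lia. apply Rplus_0_r.
Qed.

Lemma p_truncation_0 (pi : Z -> R -> R) (e t : R) :
  p_truncation pi 0 e t = pi (-1)%Z t * / e + pi 0%Z t.
Proof.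
  unfold p_truncation. rewrite sum_n_Sm, sum_n_n by lia. cbn.
  unfold plus; simpl. rewrite !Rmult_1_r. reflexivity.
Qed.

Section LeadingOrder.
Variables (qA qB : R) (q p : R -> R -> R) (chi : nat -> R -> R) (pi : Z -> R -> R).
Hypothesis Hexp : secular_expansion (hamiltonian m u0 V) qA qB q p chi pi.

Lemma q_limit (t : R) : unit_interval t -> limit_0 (fun e => q e t) (segment qA qB t).
Proof.
  intros Ht. destruct Hexp as [_ [_ [_ [Hq _]]]].
  assert (H := limit_0_sup_O _ t (uniform_remainder_sup_O _ _ (Hq 0%nat)) Ht).
  assert (H' := limit_0_plus _ _ _ _ (limit_0_const (segment qA qB t)) H).
  rewrite Rplus_0_r in H'. refine (limit_0_ext _ _ _ _ H').
  intros e _. rewrite q_truncation_0. ring.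
Qed.

Lemma eps_p_limit (t : R) :
  unit_interval t -> limit_0 (fun e => e * p e t) (pi (-1)%Z t).
Proof.
  intros Ht. destruct Hexp as [_ [_ [_ [_ Hp]]]].
  assert (H := limit_0_sup_O _ t (uniform_remainder_sup_O _ _ (Hp 0%nat)) Ht).
  assert (H' := limit_0_plus _ _ _ _ (limit_0_const (pi (-1)%Z t))
    (limit_0_mult _ _ _ _ limit_0_id
      (limit_0_plus _ _ _ _ H (limit_0_const (pi 0%Z t))))).
  rewrite Rmult_0_l, Rplus_0_r in H'. refine (limit_0_ext _ _ _ _ H').
  intros e He. cbv beta. rewrite p_truncation_0. field. lra.
Qed.

Lemma solution_eventually :
  at_right 0 (fun e => rescaled_solution (hamiltonian m u0 V) qA qB e (q e) (p e)).
Proof. apply at_right_0_iff, Hexp. Qed.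

(** The first equation reads q' = eps p / m(q) + eps u0(q). As eps -> 0+ the left side tends to
    [qB - qA] and the right side to the leading momentum divided by the mass on the segment. The
    mass may vary here, so the result serves both the necessity of constant mass and the final
    formula. *)
Lemma leading_momentum (t : R) :
  unit_interval t -> pi (-1)%Z t = m (segment qA qB t) * (qB - qA).
Proof.
  intros Ht. pose proof Hexp as [_ [_ [_ [Hq _]]]].
  assert (D : fam_deriv (fun e t => q e t - q_truncation qA qB chi 0 e t)
    (fun e t => e * Derive (fun y => hamiltonian m u0 V (q e t) y) (p e t) - (qB - qA))).
  { generalize solution_eventually. apply (filter_imp (F := at_right 0)).
    intros e [Dq _].
    refine (deriv_on_ext _ _ _ _ _ (fun _ _ => eq_refl)
      (deriv_on_minus _ _ _ _ Dq (deriv_on_segment qA qB))).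
    intros s _. rewrite q_truncation_0. reflexivity. }
  assert (H := limit_0_sup_O _ t (uniform_remainder_deriv_sup_O _ _ _ (Hq 0%nat) D) Ht).
  assert (Hm : limit_0 (fun e => / m (q e t)) (/ m (segment qA qB t))).
  { apply (limit_0_comp (fun x => / m x)); [|apply q_limit, Ht].
    apply (ex_derive_continuous (fun x => / m x)). auto_derive.
    split; [apply smooth_ex_derive, m_smooth|split; [apply m_neq0|exact I]]. }
  assert (Hu : limit_0 (fun e => e * u0 (q e t)) (0 * u0 (segment qA qB t))).
  { apply limit_0_mult; [apply limit_0_id|].
    apply limit_0_comp; [apply smooth_continuous, u0_smooth|apply q_limit, Ht]. }
  assert (H' := limit_0_plus _ _ _ _ (limit_0_plus _ _ _ _
    (limit_0_mult _ _ _ _ (eps_p_limit t Ht) Hm) Hu) (limit_0_const (- (qB - qA)))).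
  lapply (fun E => limit_0_unique _ _ _ _ E H' H); [intros E|].
  2:{ intros e _. rewrite hamiltonian_Derive_p. unfold Rdiv. ring. }
  assert (E' : pi (-1)%Z t * / m (segment qA qB t) = qB - qA) by lra.
  rewrite <- E'. field. apply m_neq0.
Qed.

Lemma smooth_on_deriv_on (f : R -> R) :
  smooth_on unit_interval f -> exists f', deriv_on f f'.
Proof.
  intros H. destruct (H 1%nat) as [g [h [Eh Dh]]]. exists g.
  refine (deriv_on_ext _ _ _ _ Eh (fun _ _ => eq_refl) _). exact Dh.
Qed.

Lemma Derive_mass_segment (t : R) :
  qA <> qB -> unit_interval t -> Derive m (segment qA qB t) = 0.
Proof.
  intros Hne Ht. pose proof Hexp as [_ [_ [Hpi [_ Hp]]]].
  destruct (smooth_on_deriv_on _ (Hpi (-1)%Z ltac:(lia))) as [a Da].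
  destruct (smooth_on_deriv_on _ (Hpi 0%Z ltac:(lia))) as [b Db].
  assert (D : fam_deriv (fun e t => p e t - p_truncation pi 0 e t)
    (fun e t => - e * Derive (fun x => hamiltonian m u0 V x (p e t)) (q e t)
                - (/ e * a t + b t))).
  { generalize solution_eventually. apply (filter_imp (F := at_right 0)).
    intros e [_ [Dp _]].
    refine (deriv_on_ext _ _ _ _ _ (fun _ _ => eq_refl)
      (deriv_on_minus _ _ _ _ Dp (deriv_on_plus _ _ _ _ (deriv_on_scal (/ e) _ _ Da) Db))).
    intros s _. rewrite p_truncation_0. ring. }
  assert (H := limit_0_sup_O _ t (uniform_remainder_deriv_sup_O _ _ _ (Hp 0%nat) D) Ht).
  (* The derivative of [p] grows like [a / e]; multiplying the second equation by [e] gives both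
     sides finite limits. This is the left side, with limit [a t]. *)
  assert (H1 := limit_0_plus _ _ _ _ (limit_0_const (a t))
    (limit_0_mult _ _ _ _ limit_0_id
      (limit_0_plus _ _ _ _ H (limit_0_const (b t))))).
  rewrite Rmult_0_l, Rplus_0_r in H1.
  assert (Hq := q_limit t Ht). assert (Hep := eps_p_limit t Ht).
  assert (Hm : limit_0 (fun e => / m (q e t)) (/ m (segment qA qB t))).
  { apply (limit_0_comp (fun x => / m x)); [|exact Hq].
    apply (ex_derive_continuous (fun x => / m x)). auto_derive.
    split; [apply smooth_ex_derive, m_smooth|split; [apply m_neq0|exact I]]. }
  assert (Hc : forall F, smooth F ->
            limit_0 (fun e => Derive F (q e t)) (Derive F (segment qA qB t))).
  { intros F HF. apply limit_0_comp; [|exact Hq].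
    apply smooth_continuous, smooth_Derive, HF. }
  (* The right side, minus [e ^ 2] times the position derivative of the Hamiltonian: the quadratic
     term is grouped as half of m' times the square of [e * p / m], and the others keep a factor
     [e]. *)
  assert (H2 := limit_0_plus _ _ _ _
    (limit_0_mult _ _ _ _ (limit_0_const (/ 2))
      (limit_0_mult _ _ _ _ (Hc m m_smooth)
        (limit_0_mult _ _ _ _ (limit_0_mult _ _ _ _ Hm Hep)
                              (limit_0_mult _ _ _ _ Hm Hep))))
    (limit_0_mult _ _ _ _ limit_0_id
      (limit_0_mult _ _ _ _ (limit_0_const (-1))
        (limit_0_plus _ _ _ _ (limit_0_mult _ _ _ _ (Hc u0 u0_smooth) Hep)
          (limit_0_mult _ _ _ _ limit_0_id (Hc V V_smooth)))))).
  rewrite !Rmult_0_l, Rplus_0_r in H2.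
  lapply (fun E => limit_0_unique _ _ _ _ E H1 H2); [intros E|].
  2:{ intros e He. cbv beta. rewrite hamiltonian_Derive_q. field.
      split; [apply m_neq0|lra]. }
  assert (Da' : deriv_on (pi (-1)%Z)
    (fun s => (qB - qA) * ((qB - qA) * Derive m (segment qA qB s)))).
  { refine (deriv_on_ext _ _ _ _ _ (fun _ _ => eq_refl)
      (deriv_on_scal (qB - qA) _ _
        (deriv_on_comp _ _ _ _ (smooth_is_derive _ m_smooth) (deriv_on_segment qA qB)))).
    intros s Hs. rewrite (leading_momentum s Hs). ring. }
  rewrite (deriv_on_unique _ _ _ Da Da' t Ht), (leading_momentum t Ht) in E.
  replace (/ m (segment qA qB t) * (m (segment qA qB t) * (qB - qA))) with (qB - qA) in E
    by (field; apply m_neq0).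
  assert (E' : (qB - qA) * ((qB - qA) * Derive m (segment qA qB t)) = 0) by lra.
  apply Rmult_integral in E'. destruct E' as [E'|E']; [lra|].
  apply Rmult_integral in E'. destruct E' as [E'|E']; [lra|exact E'].
Qed.

End LeadingOrder.

Lemma constant_mass_of_valid :
  (forall qA qB, qA <> qB -> secular_expansion_valid (hamiltonian m u0 V) qA qB) ->
  exists m0, forall x, m x = m0.
Proof.
  intros H.
  assert (Dm : forall x, Derive m x = 0).
  { intros x. destruct (H x (x + 1) ltac:(lra)) as [q [p [chi [pi Hexp]]]].
    replace x with (segment x (x + 1) 0) by (unfold segment; ring).
    apply (Derive_mass_segment _ _ _ _ _ _ Hexp); [lra|unfold unit_interval; lra]. }
  exists (m 0). intros x.
  destruct (MVT_gen m 0 x (Derive m)) as [c [_ E]].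
  - intros z _. apply smooth_is_derive, m_smooth.
  - intros z _. apply continuity_pt_filterlim, smooth_continuous, m_smooth.
  - rewrite Dm in E. lra.
Qed.

End Hamiltonian.

Theorem proposition5 (m u0 V : R -> R)
    (m_smooth : smooth m) (u0_smooth : smooth u0) (V_smooth : smooth V)
    (m_neq0 : forall q : R, m q <> 0)
    (inv_m_pos : forall q : R, 0 < / m q)
    (inv_m_bounded_away : exists c : R, 0 < c /\ forall q : R, c <= / m q) :
  ((forall qA qB : R, qA <> qB ->
      secular_expansion_valid (hamiltonian m u0 V) qA qB)
   <-> (exists m0 : R, forall q : R, m q = m0))
  /\
  (forall m0 : R, (forall q : R, m q = m0) ->
   forall (qA qB : R), qA <> qB ->
   forall (q p : R -> R -> R) (chi : nat -> R -> R) (pi : Z -> R -> R),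
     secular_expansion (hamiltonian m u0 V) qA qB q p chi pi ->
     forall tau : R, 0 <= tau <= 1 -> pi (-1)%Z tau = m0 * (qB - qA)).
Proof.
  split; [split|].
  - apply constant_mass_of_valid; assumption.
  - intros [m0 Hm] qA qB _.
    apply secular_expansion_valid_of_constant_mass with m0; assumption.
  - intros m0 Hm qA qB _ q p chi pi Hexp tau Htau.
    rewrite <- (Hm (segment qA qB tau)).
    exact (leading_momentum m u0 V m_smooth u0_smooth m_neq0 qA qB q p chi pi Hexp tau Htau).
Qed.
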